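(* Let $R$ be a regular local ring of Krull dimension at least two. Let $\{R_i\}_{i=0}^\infty$ be a sequence of overrings of $R$ such that $R=R_0$ and for each $i\ge 0$, $R_{i+1}$ is a local quadratic transform of $R_i$ of Krull dimension at least two. For each $i$, let $V_i$ be the order valuation ring of $R_i$. Then the ring $A=\bigcap_{i=1}^\infty V_i$ is a Prüfer domain, and the boundary valuation ring of $\{R_i\}_{i=0}^\infty$ is the localization of $A$ at the only maximal ideal of $A$ that is not (finitely generated and of height one), i.e. the only maximal ideal of $A$ that fails to be both finitely generated and of height one.
   Context: Let $F$ be the quotient field of $R$; overrings of $R$ are rings between $R$ and $F$. If $S$ is a regular local ring with maximal ideal $\mathfrak m$, $x\in\mathfrak m\setminus\mathfrak m^2$, and $P$ is a prime ideal of $S[\mathfrak m x^{-1}]$ containing $\mathfrak m$, then the (regular local) ring $S[\mathfrak m x^{-1}]_P$ is called a local quadratic transform of $S$. The order valuation ring of $S$ is the DVR $S[\mathfrak m x^{-1}]_{\mathfrak m S[\mathfrak m x^{-1}]}$; equivalently the valuation ring of the valuation $v$ of the quotient field of $S$ determined by $v(r)=\max\{i: r\in\mathfrak m^i\}$ for $0\neq r\in S$. A valuation ring of $F$ is a subring $V$ of $F$ such that for each $0\ne t\in F$, $t\in V$ or $t^{-1}\in V$; $\operatorname{Zar}(F)$ is the set of all of these. The patch topology on $\operatorname{Zar}(F)$ has as a basis the sets $\{V: x_1,\dots,x_n\in V,\ y_1\notin V,\dots,y_m\notin V\}$ with $x_i,y_j\in F$, $n,m\ge 0$. A patch limit point of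 $X\subseteq \operatorname{Zar}(F)$ is a $U\in\operatorname{Zar}(F)$ such that every patch open neighborhood of $U$ contains a point of $X$ different from $U$. It is a known theorem (Heinzer, Loper, Olberding, Schoutens, Toeniskoetter) that for a sequence $\{R_i\}$ as in the claim, the set of order valuation rings $\{V_i\}$ has a unique patch limit point in $\operatorname{Zar}(F)$; this valuation ring is called the boundary valuation ring of the sequence $\{R_i\}$. A Prüfer domain is a domain whose localization at each maximal ideal is a valuation domain. *)

(* Defs.v *)
From HB Require Import structures.
From mathcomp Require Import all_boot all_order all_algebra.
From mathcomp Require Import boolp classical_sets functions cardinality topology.

Set Implicit Arguments.
Unset Strict Implicit.
Unset Printing Implicit Defensive.

Import GRing.Theory.
Local Open Scope classical_set_scope.
Local Open Scope ring_scope.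

(* All rings are subrings of a fixed field F, represented as sets of elements
   of F; ideals of such a ring A are represented as subsets of A. *)
Section RingsInAField.
Variable F : fieldType.
Implicit Types A B I J M P S T V X : set F.

Definition subring A : Prop := GRing.subring_closed (mem A).

Definition adjoin A X : set F := smallest subring (A `|` X).

Definition ideal A I : Prop :=
  [/\ I `<=` A, I 0, forall x y, I x -> I y -> I (x + y)
    & forall a x, A a -> I x -> I (a * x)].

Definition ideal_span A X : set F := smallest (ideal A) X.

Definition ideal_mul A I J : set F :=
  ideal_span A [set x * y | x in I & y in J].

Definition ideal_pow A I n : set F := iter n (ideal_mul A I) A.

Definition fg_ideal A I : Prop :=
  exists2 X, finite_set X & I = ideal_span A X.

Definition prime_ideal A P : Prop :=
  [/\ ideal A P, ~ P 1
    & forall a b, A a -> A b -> P (a * b) -> P a \/ P b].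

Definition maximal_ideal A M : Prop :=
  [/\ ideal A M, M <> A
    & forall J, ideal A J -> M `<=` J -> J = M \/ J = A].

Definition localization A P : set F :=
  [set x | exists a s, [/\ A a, A s, ~ P s & x = a / s]].

Definition quotient_field A : set F := localization A [set 0].

Definition overring R A : Prop := subring A /\ R `<=` A.

Definition prime_chain A n (p : nat -> set F) : Prop :=
  (forall i, (i <= n)%N -> prime_ideal A (p i)) /\
  (forall i, (i < n)%N -> p i `<` p i.+1).

Definition krull_dim A d : Prop :=
  (exists p, prime_chain A d p) /\
  (forall n p, prime_chain A n p -> (n <= d)%N).

Definition krull_dim_ge2 A : Prop := exists2 d, krull_dim A d & (2 <= d)%N.

Definition height A P h : Prop :=
  (exists2 p, prime_chain A h p & p h = P) /\
  (forall n p, prime_chain A n p -> p n = P -> (n <= h)%N).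

Definition noetherian A : Prop := forall I, ideal A I -> fg_ideal A I.

Definition local_ring A M : Prop :=
  maximal_ideal A M /\ forall N, maximal_ideal A N -> N = M.

(* The subring A is a regular local ring with maximal ideal M: it is
   Noetherian and local, and M is generated by dim A elements. *)
Definition regular_local_ring A M : Prop :=
  [/\ subring A, noetherian A, local_ring A M
    & exists2 d, krull_dim A d
        & exists2 s : seq F, size s = d & M = ideal_span A [set` s]].

(* S[M x^-1] *)
Definition blowup_chart S M (x : F) : set F :=
  adjoin S [set y / x | y in M].

Definition local_quadratic_transform S T : Prop :=
  exists M x P,
    [/\ regular_local_ring S M, M x /\ ~ ideal_pow S M 2 x,
        prime_ideal (blowup_chart S M x) P, M `<=` P
      & T = localization (blowup_chart S M x) P].

(* The ring V below does not depend on the choice of x in M \ M^2. *)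
Definition order_valuation_ring S V : Prop :=
  exists M x,
    [/\ regular_local_ring S M, M x /\ ~ ideal_pow S M 2 x
      & V = localization (blowup_chart S M x)
              (ideal_span (blowup_chart S M x) M)].

(* Valuation rings of F itself, as opposed to domains that are valuation rings
   of their own quotient field, which may be smaller than F. *)
Definition valuation_ring V : Prop :=
  subring V /\ forall t, t != 0 -> V t \/ V t^-1.

Definition valuation_domain V : Prop :=
  subring V /\ forall t, quotient_field V t -> t != 0 -> V t \/ V t^-1.

Definition prufer_domain A : Prop :=
  subring A /\
  forall M, maximal_ideal A M -> valuation_domain (localization A M).

Definition zar : Type := [set V | valuation_ring V].

HB.instance Definition _ := Choice.on zar.

Definition patch_base (XY : set F * set F) : set zar :=
  [set V | XY.1 `<=` val V /\ XY.2 `<=` ~` val V].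

Definition patch_index : set (set F * set F) :=
  [set XY | finite_set XY.1 /\ finite_set XY.2].

Fact patch_base_cover : \bigcup_(XY in patch_index) patch_base XY = setT.
Proof.
apply/seteqP; split=> // V _.
exists (set0, set0); first by split; exact: finite_set0.
by split; exact: sub0set.
Qed.

Fact patch_base_join (i j : set F * set F) (V : zar) :
  patch_index i -> patch_index j -> patch_base i V -> patch_base j V ->
  exists k, [/\ patch_index k, patch_base k V
              & patch_base k `<=` patch_base i `&` patch_base j].
Proof.
move=> [fi1 fi2] [fj1 fj2] [Vi1 Vi2] [Vj1 Vj2].
exists (i.1 `|` j.1, i.2 `|` j.2); split.
- by split; rewrite /= finite_setU.
- by split; rewrite /= subUset.
- by move=> W [] /=; rewrite !subUset => -[? ?] [? ?].
Qed.

HB.instance Definition _ :=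
  isBaseTopological.Build zar patch_base_cover patch_base_join.

(* U is the unique patch limit point of the set {V_i}. *)
Definition boundary_valuation_ring (V : nat -> set F) (U : zar) : Prop :=
  limit_point [set W : zar | range V (val W)] = [set U].

End RingsInAField.

(* Main.v *)
Require Import Defs.
From mathcomp Require Import all_boot all_order all_algebra.
From mathcomp Require Import boolp classical_sets functions cardinality topology.
From mathcomp Require Import mpoly ring zify.

(* For t in F write t = a/b and follow the transforms of the ideal (a, b) along the
   sequence.  The order of these transforms never increases, so it is eventually a
   constant e, and from then on an element a or b of order e keeps order e.  Hence
   the sign of v_i(t) is eventually constant, which makes
   U = {t : t in V_i for large i} a valuation ring of F, the only patch limit point.
   The same argument shows that if v_i(t) = 0 for large i, then
   u = 1 + t + ... + t^m is a unit of V_i for all large i as soon as it is a unit of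
   one V_N with N independent of m; choosing m divisible by finitely many integers
   gives v_i(u) = m min(0, v_i(t)) for all i.  Then t^j / u is in A for j <= m and
   these elements sum to 1, so t or 1/t is in every localization of A at a prime.
   The same trick shows that every proper ideal of A is contained in the center of
   U or of some V_i.

   That the order of a transform does not increase rests on two facts.  First, the
   associated graded ring of a d-dimensional regular local ring is a polynomial
   ring: otherwise the lengths of chains of ideals above m^N are O(N^(d-1)), while
   by the Artin-Rees lemma each step of a chain of primes lowers this growth by one
   degree.  Second, a nonzero polynomial of degree at most r over a field is not in
   P^(r+1) after localization at a prime P, as a translation to the generic point
   of P shows. *)

Set Implicit Arguments.
Unset Strict Implicit.
Unset Printing Implicit Defensive.

Import Order.TTheory GRing.Theory.
Local Open Scope classical_set_scope.
Local Open Scope ring_scope.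

(** * Ideals of subrings of a field *)

(** Regularity is given only by a count: the maximal ideal has as many generators as the Krull
    dimension. It is used in one form: a homogeneous form with a coefficient outside the maximal
    ideal takes a value at the parameters that does not drop into the next power. This makes the
    order additive, hence each V_i a valuation ring, and makes the translation of the blowup chart
    well defined. Residue rings are never formed: polynomials have coefficients in subrings of F,
    and congruences modulo an ideal are conditions on coefficients.

    The exponent m has to serve all V_n at once, while each single V_n only gives a divisibility
    condition on m. So the tail of the sequence must be governed by one index N chosen before m; the
    product of the finitely many remaining conditions is then available.

    Dimension at least two enters through V_(n+1) being different from V_n: if no nonzero nonunit of
    R_(n+1) had its inverse in V_n, then R_(n+1) would be V_n, of dimension at most one. Hence U is
    a limit point and its center is not finitely generated. An element outside that center is a unit
    in almost all V_n, so each other maximal ideal is cut out by finitely many conditions. *)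

Section Subrings.
Variables (F : fieldType) (A : set F).

Lemma subringP :
  subring A <-> [/\ A 1, forall x y, A x -> A y -> A (x - y)
                  & forall x y, A x -> A y -> A (x * y)].
Proof.
split=> [[h1 h2 h3]|[h1 h2 h3]].
  split=> [|x y hx hy|x y hx hy]; first by have := h1; rewrite inE.
    by have := h2 x y; rewrite !inE; apply.
  by have := h3 x y; rewrite !inE; apply.
by split=> [|x y|x y]; rewrite !inE //; [exact: h2|exact: h3].
Qed.

Hypothesis hA : subring A.

Lemma sring1 : A 1. Proof. by case/subringP: hA. Qed.
Lemma sringB x y : A x -> A y -> A (x - y).
Proof. by case/subringP: hA => _ + _; apply. Qed.
Lemma sringM x y : A x -> A y -> A (x * y).
Proof. by case/subringP: hA => _ _; apply. Qed.
Lemma sring0 : A 0. Proof. by rewrite -(subrr 1); apply: sringB; exact: sring1. Qed.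
Lemma sringN x : A x -> A (- x).
Proof. by move=> hx; rewrite -sub0r; apply: sringB => //; exact: sring0. Qed.
Lemma sringD x y : A x -> A y -> A (x + y).
Proof. by move=> hx hy; rewrite -(opprK y); apply: sringB => //; exact: sringN. Qed.
Lemma sringX x n : A x -> A (x ^+ n).
Proof.
by move=> hx; elim: n => [|n IH]; [exact: sring1|rewrite exprS; exact: sringM].
Qed.
Lemma sring_sum (I : Type) (r : seq I) (P : pred I) (f : I -> F) :
  (forall i, P i -> A (f i)) -> A (\sum_(i <- r | P i) f i).
Proof. by move=> h; elim/big_ind: _ => //; [exact: sring0|exact: sringD]. Qed.
Lemma sring_prod (I : Type) (r : seq I) (P : pred I) (f : I -> F) :
  (forall i, P i -> A (f i)) -> A (\prod_(i <- r | P i) f i).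
Proof. by move=> h; elim/big_ind: _ => //; [exact: sring1|exact: sringM]. Qed.
Lemma sring_nat n : A n%:R.
Proof.
elim: n => [|n IH]; first exact: sring0.
by rewrite -addn1 natrD; apply: sringD => //; exact: sring1.
Qed.

Lemma ideal_self : ideal A A.
Proof. by split=> //; [exact: sring0|exact: sringD|exact: sringM]. Qed.

Section Ideal.
Variable I : set F.
Hypothesis hI : ideal A I.

Lemma idS : I `<=` A. Proof. by case: hI. Qed.
Lemma id0 : I 0. Proof. by case: hI. Qed.
Lemma idD x y : I x -> I y -> I (x + y). Proof. by case: hI => _ _ + _; apply. Qed.
Lemma idM a x : A a -> I x -> I (a * x). Proof. by case: hI => _ _ _; apply. Qed.
Lemma idMr a x : A a -> I x -> I (x * a). Proof. by rewrite mulrC; exact: idM. Qed.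
Lemma idN x : I x -> I (- x).
Proof. by move=> hx; rewrite -mulN1r; apply: idM => //; apply: sringN; exact: sring1. Qed.
Lemma idB x y : I x -> I y -> I (x - y).
Proof. by move=> hx hy; apply: idD => //; exact: idN. Qed.
Lemma id_addl x y : I x -> I (x + y) -> I y.
Proof. by move=> hx hxy; rewrite -[y](addKr x) addrC; apply: idB. Qed.
Lemma id_sum (J : Type) (r : seq J) (P : pred J) (f : J -> F) :
  (forall i, P i -> I (f i)) -> I (\sum_(i <- r | P i) f i).
Proof. by move=> h; elim/big_ind: _ => //; [exact: id0|exact: idD]. Qed.
Lemma ideal_eqT : I 1 -> I = A.
Proof.
move=> h1; apply/seteqP; split; first exact: idS.
by move=> x hx; rewrite -(mulr1 x); exact: idM.
Qed.
End Ideal.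

Lemma ideal_span_ideal X : X `<=` A -> ideal A (ideal_span A X).
Proof.
move=> hX; split.
- by move=> x; apply; split => //; exact: ideal_self.
- by move=> J [hJ _]; exact: id0 hJ.
- by move=> x y hx hy J hJ; apply: (idD hJ.1); [exact: hx|exact: hy].
- by move=> a x ha hx J hJ; apply: (idM hJ.1) => //; exact: hx.
Qed.

Lemma sub_ideal_span X : X `<=` ideal_span A X.
Proof. by move=> x hx J [_]; exact. Qed.

Lemma ideal_span_sub X I : ideal A I -> X `<=` I -> ideal_span A X `<=` I.
Proof. by move=> hI hX x; apply. Qed.

Definition idealD I J : set F := [set z | exists x y, [/\ I x, J y & z = x + y]].
Definition principal y : set F := [set z | exists2 a, A a & z = a * y].
Definition scale_ideal y I : set F := [set z | exists2 a, I a & z = a * y].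
Definition colon I y : set F := [set z | A z /\ I (z * y)].

Lemma idealD_ideal I J : ideal A I -> ideal A J -> ideal A (idealD I J).
Proof.
move=> hI hJ; split.
- by move=> _ [x [y [hx hy ->]]]; apply: sringD; [exact: (idS hI)|exact: (idS hJ)].
- by exists 0, 0; rewrite addr0; split=> //; [exact: id0 hI|exact: id0 hJ].
- move=> _ _ [x [y [hx hy ->]]] [x' [y' [hx' hy' ->]]].
  by exists (x + x'), (y + y'); split; [exact: idD|exact: idD|ring].
- move=> a _ ha [x [y [hx hy ->]]].
  by exists (a * x), (a * y); split; [exact: idM|exact: idM|ring].
Qed.

Lemma idealDl I J : ideal A J -> I `<=` idealD I J.
Proof. by move=> hJ x hx; exists x, 0; rewrite addr0; split=> //; exact: id0 hJ. Qed.

Lemma idealDr I J : ideal A I -> J `<=` idealD I J.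
Proof. by move=> hI x hx; exists 0, x; rewrite add0r; split=> //; exact: id0 hI. Qed.

Lemma idealD_sub I J K : ideal A K -> I `<=` K -> J `<=` K -> idealD I J `<=` K.
Proof. by move=> hK h1 h2 _ [x [y [hx hy ->]]]; apply: (idD hK); auto. Qed.

Lemma idealD_mono I I' J J' : I `<=` I' -> J `<=` J' -> idealD I J `<=` idealD I' J'.
Proof. by move=> h1 h2 _ [x [y [hx hy ->]]]; exists x, y; split; auto. Qed.

Lemma scale_ideal_ideal y I : A y -> ideal A I -> ideal A (scale_ideal y I).
Proof.
move=> hy hI; split.
- by move=> _ [a ha ->]; apply: sringM => //; exact: (idS hI).
- by exists 0; rewrite ?mul0r //; exact: id0 hI.
- by move=> _ _ [a ha ->] [b hb ->]; exists (a + b); [exact: idD|ring].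
- by move=> c _ hc [a ha ->]; exists (c * a); [exact: idM|ring].
Qed.

Lemma principal_ideal y : A y -> ideal A (principal y).
Proof. by move=> hy; apply: scale_ideal_ideal => //; exact: ideal_self. Qed.

Lemma principal_self y : principal y y.
Proof. by exists 1; rewrite ?mul1r //; exact: sring1. Qed.

Lemma colon_ideal I y : A y -> ideal A I -> ideal A (colon I y).
Proof.
move=> hy hI; split.
- by move=> z [].
- by split; [exact: sring0|rewrite mul0r; exact: id0 hI].
- by move=> a b [ha1 ha2] [hb1 hb2]; split; [exact: sringD|rewrite mulrDl; exact: idD].
- by move=> c a hc [ha1 ha2]; split; [exact: sringM|rewrite -mulrA; exact: idM].
Qed.

Lemma span_range (d : nat) (x : 'I_d -> F) : (forall i, A (x i)) ->
  forall z, ideal_span A (range x) z <->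
    exists2 c : 'I_d -> F, (forall i, A (c i)) & z = \sum_i c i * x i.
Proof.
move=> hx z; split=> [|[c hc ->]]; last first.
  have hI : ideal A (ideal_span A (range x)).
    by apply: ideal_span_ideal => _ [i _ <-].
  apply: (id_sum hI) => i _; apply: (idM hI) => //.
  by apply: sub_ideal_span; exists i.
pose K := [set z | exists2 c : 'I_d -> F, (forall i, A (c i)) & z = \sum_i c i * x i].
move: z; apply: (@ideal_span_sub _ K).
  split.
  - by move=> _ [c hc ->]; apply: sring_sum => i _; exact: sringM.
  - exists (fun=> 0) => [_|]; first exact: sring0.
    by rewrite big1 // => i _; rewrite mul0r.
  - move=> _ _ [c hc ->] [c' hc' ->]; exists (fun i => c i + c' i).
      by move=> i; exact: sringD.
    by rewrite -big_split /=; apply: eq_bigr => i _; rewrite mulrDl.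
  - move=> a _ ha [c hc ->]; exists (fun i => a * c i).
      by move=> i; exact: sringM.
    by rewrite mulr_sumr; apply: eq_bigr => i _; rewrite mulrA.
move=> _ [i _ <-]; exists (fun j => (j == i)%:R).
  by move=> j; exact: sring_nat.
rewrite (bigD1 i) //= eqxx mul1r big1 ?addr0 // => j /negPf ->.
by rewrite mul0r.
Qed.

Section Power.
Variable M : set F.
Hypothesis hM : ideal A M.

Lemma ideal_mul_sub I J K : ideal A K -> (forall x y, I x -> J y -> K (x * y)) ->
  ideal_mul A I J `<=` K.
Proof. by move=> hK h; apply: ideal_span_sub => // _ [x hx [y hy <-]]; exact: h. Qed.

Lemma ideal_mul_ideal I J : ideal A I -> ideal A J -> ideal A (ideal_mul A I J).
Proof.
move=> hI hJ; apply: ideal_span_ideal => _ [x hx [y hy <-]].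
by apply: sringM; [exact: (idS hI)|exact: (idS hJ)].
Qed.

Lemma ideal_mul_mem (I J : set F) x y : I x -> J y -> ideal_mul A I J (x * y).
Proof. by move=> hx hy; apply: sub_ideal_span; exists x => //; exists y. Qed.

Lemma ideal_pow_ideal n : ideal A (ideal_pow A M n).
Proof. by elim: n => [|n IH]; [exact: ideal_self|exact: ideal_mul_ideal]. Qed.

Lemma ideal_powS n x y : M x -> ideal_pow A M n y -> ideal_pow A M n.+1 (x * y).
Proof. exact: ideal_mul_mem. Qed.

Lemma ideal_pow1 x : M x -> ideal_pow A M 1 x.
Proof. by move=> hx; rewrite -(mulr1 x); apply: ideal_powS => //; exact: sring1. Qed.

Lemma ideal_pow1E : ideal_pow A M 1 = M.
Proof.
apply/seteqP; split => [|x]; last exact: ideal_pow1.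
by apply: ideal_mul_sub => // x y hx hy; exact: (idMr hM).
Qed.

Lemma ideal_pow_sub n : ideal_pow A M n.+1 `<=` ideal_pow A M n.
Proof.
have hI := ideal_pow_ideal n.
by apply: ideal_mul_sub => // x y hx hy; apply: (idM hI) => //; exact: (idS hM).
Qed.

Lemma ideal_pow_le n k : (n <= k)%N -> ideal_pow A M k `<=` ideal_pow A M n.
Proof.
move/subnK <-; elim: (k - n)%N => [//|i IH].
by apply: subset_trans IH; exact: ideal_pow_sub.
Qed.

Lemma ideal_powD n k x y : ideal_pow A M n x -> ideal_pow A M k y ->
  ideal_pow A M (n + k) (x * y).
Proof.
elim: n x => [|n IH] x; first by rewrite add0n => hx hy; exact: (idM (ideal_pow_ideal k)).
move=> hx hy; have hK := ideal_pow_ideal (n.+1 + k).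
suff h : ideal_pow A M n.+1 `<=` [set z | ideal_pow A M n z /\ ideal_pow A M (n.+1 + k) (z * y)].
  by case: (h _ hx).
have hI := ideal_pow_ideal n.
apply: ideal_mul_sub.
  split.
  - by move=> z [hz _]; exact: (idS hI).
  - by split; [exact: (id0 hI)|rewrite mul0r; exact: (id0 hK)].
  - move=> a b [ha1 ha2] [hb1 hb2].
    by split; [exact: (idD hI)|rewrite mulrDl; exact: (idD hK)].
  - by move=> c a hc [ha1 ha2]; split; [exact: (idM hI)|rewrite -mulrA; exact: (idM hK)].
move=> u v hu hv; split.
  by apply: (idM hI) => //; exact: (idS hM).
by rewrite -mulrA addSn; apply: ideal_powS => //; exact: IH.
Qed.

Lemma ideal_powX n r x : ideal_pow A M r x -> ideal_pow A M (r * n) (x ^+ n).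
Proof.
move=> hx; elim: n => [|n IH]; first by rewrite muln0; exact: sring1.
by rewrite exprS mulnS; exact: ideal_powD.
Qed.

End Power.

(** * Noetherian local subrings *)

Section Noetherian.
Hypothesis noeth : noetherian A.

Lemma noetherian_acc (J : nat -> set F) : (forall n, ideal A (J n)) ->
  (forall n, J n `<=` J n.+1) -> exists n, J n.+1 = J n.
Proof.
move=> hJ hmon.
have hle n k : (n <= k)%N -> J n `<=` J k.
  by move/subnK <-; elim: (k - n)%N => [//|i IH]; apply: subset_trans IH _; exact: hmon.
pose K := \bigcup_n J n.
have hK : ideal A K.
  split.
  - by move=> x [n _]; exact: (idS (hJ n)).
  - by exists 0%N => //; exact: id0 (hJ _).
  - move=> x y [n _ hx] [k _ hy]; exists (maxn n k) => //.
    by apply: (idD (hJ _)); [apply: hle hx; exact: leq_maxl|apply: hle hy; exact: leq_maxr].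
  - by move=> a x ha [n _ hx]; exists n => //; exact: (idM (hJ n)).
have [X finX eX] := noeth hK.
have hX : X `<=` K by rewrite eX; exact: sub_ideal_span.
have [N hN] : exists N, X `<=` J N.
  have /finite_seqP [s es] := finX; move: hX; rewrite es {es}.
  elim: s => [|y s IH] hs; first by exists 0%N.
  have [N hN] : exists N, [set` s] `<=` J N.
    by apply: IH => z hz; apply: hs; rewrite /= inE hz orbT.
  have [k _ hk] : K y by apply: hs; rewrite /= inE eqxx.
  exists (maxn N k) => z; rewrite /= inE => /orP[/eqP ->|hz].
    by apply: hle hk; exact: leq_maxr.
  by apply: hle (hN z hz); exact: leq_maxl.
exists N; apply/seteqP; split; last exact: hmon.
move=> x hx; have : K x by exists N.+1.
by rewrite eX; apply: ideal_span_sub.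
Qed.

(** By dependent choice, the absence of a maximal member above [I0] would give a strictly increasing
    sequence of ideals. *)
Lemma noetherian_max (P : set F -> Prop) I0 : (forall I, P I -> ideal A I) -> P I0 ->
  exists I, [/\ P I, I0 `<=` I & forall J, P J -> I `<=` J -> J = I].
Proof.
move=> hP hI0; apply: contrapT => hno.
have step (I : {I : set F | P I /\ I0 `<=` I}) :
    {J : {I : set F | P I /\ I0 `<=` I} | sval I `<` sval J}.
  apply: cid; apply: contrapT => hI; apply: hno; exists (sval I).
  case: I hI => I [h1 h2] /= hI; split=> // J hJ hIJ.
  apply: contrapT => hne; apply: hI.
  have h3 : P J /\ I0 `<=` J by split=> //; exact: subset_trans hIJ.
  exists (exist _ J h3) => /=; split=> // hJI; apply: hne.
  by apply/seteqP.
pose I0' : {I : set F | P I /\ I0 `<=` I} := exist _ I0 (conj hI0 (fun x h => h)).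
pose J := fix J n := if n is k.+1 then sval (step (J k)) else I0'.
have hJ n : sval (J n) `<` sval (J n.+1) by exact: svalP (step (J n)).
have [n hn] := @noetherian_acc (fun n => sval (J n)) (fun n => hP _ (svalP (J n)).1)
   (fun n => (hJ n).1).
by have [_] := hJ n; rewrite hn; apply.
Qed.

Variable M : set F.
Hypothesis locM : local_ring A M.

Lemma local_maximal : maximal_ideal A M. Proof. by case: locM. Qed.
Lemma local_ideal : ideal A M. Proof. by case: local_maximal. Qed.
Lemma local_n1 : ~ M 1.
Proof.
move=> h1; case: local_maximal => hM hne _; apply: hne.
exact: ideal_eqT.
Qed.

Lemma local_proper_sub I : ideal A I -> ~ I 1 -> I `<=` M.
Proof.
move=> hI h1.
have [N [[hN1 hN2] hIN hmax]] :=
  @noetherian_max (fun I => ideal A I /\ ~ I 1) I (fun _ h => h.1) (conj hI h1).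
suff <- : N = M by [].
apply: locM.2; split=> // [eN|J hJ hNJ]; first by apply: hN2; rewrite eN; exact: sring1.
have [hJ1|hJ1] := pselect (J 1); first by right; exact: ideal_eqT.
by left; apply: hmax.
Qed.

Lemma local_unit a : A a -> ~ M a -> A a^-1.
Proof.
move=> ha hMa.
have [[b hb e]|h1] := pselect (principal a 1).
  suff -> : a^-1 = b by [].
  have a0 : a != 0 by apply/eqP => a0; move: e; rewrite a0 mulr0 => /eqP; rewrite oner_eq0.
  by apply: (mulIf a0); rewrite mulVf.
case: hMa; apply: (local_proper_sub (principal_ideal ha) h1).
exact: principal_self.
Qed.

Lemma local_sub1 a : M a -> A (1 - a)^-1.
Proof.
move=> ha; apply: local_unit => [|h].
  by apply: sringB; [exact: sring1|exact: (idS local_ideal)].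
by apply: local_n1; rewrite -(subrK a 1); apply: (idD local_ideal).
Qed.

Lemma local_prime a b : A a -> A b -> M (a * b) -> M a \/ M b.
Proof.
move=> ha hb hab; have [h|h] := pselect (M a); [by left|right].
have a0 : a != 0 by apply/eqP => a0; apply: h; rewrite a0; exact: (id0 local_ideal).
by rewrite -(mulKf a0 b); apply: (idM local_ideal) => //; exact: local_unit.
Qed.

Lemma local_prime_ideal : prime_ideal A M.
Proof. by split; [exact: local_ideal|exact: local_n1|exact: local_prime]. Qed.

Lemma one_sub_neq0 a : M a -> 1 - a != 0.
Proof.
move=> ha; apply/eqP => /eqP; rewrite subr_eq0 => /eqP e.
by apply: local_n1; rewrite e.
Qed.

End Noetherian.
End Subrings.

(** * Leading exponents and the Artin-Rees lemma *)

Section Dickson.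
Variable d : nat.

(** Choosing at each stage an index that minimizes [f] on the whole remaining tail makes the chosen
    values nondecreasing. *)
Lemma nondecreasing_subseq (f : nat -> nat) :
  exists g : nat -> nat, (forall i j, (i < j)%N -> (g i < g j)%N) /\
    (forall i j, (i <= j)%N -> (f (g i) <= f (g j))%N).
Proof.
have minx n : exists k, (n <= k)%N /\ forall j, (n <= j)%N -> (f k <= f j)%N.
  have [m hm] : exists m, exists2 k, (n <= k)%N & f k = m by exists (f n), n.
  elim/ltn_ind: m hm => m IH [k hk ek].
  have [h|/existsNP [j /not_implyP[hj /negP]]] := pselect (forall j, (n <= j)%N -> (f k <= f j)%N).
    by exists k.
  by rewrite -ltnNge ek => hlt; apply: (IH (f j)) => //; exists j.
pose nx n := sval (cid (minx n)).
have nx1 n : (n <= nx n)%N by rewrite /nx; case: cid => k [].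
have nx2 n j : (n <= j)%N -> (f (nx n) <= f j)%N.
  by rewrite /nx; case: cid => k [_] /=; apply.
pose g := fix g i := if i is k.+1 then nx (g k).+1 else nx 0%N.
have gS i : (g i < g i.+1)%N by exact: nx1.
have gmon i j : (i < j)%N -> (g i < g j)%N.
  elim: j => // j IH; rewrite ltnS leq_eqVlt => /orP[/eqP ->|/IH h]; first exact: gS.
  exact: ltn_trans h (gS j).
exists g; split=> // i j; rewrite leq_eqVlt => /orP[/eqP -> //|hij].
have [n [hn1 hn2]] : exists n, (forall k, (i < k)%N -> (n <= g k)%N) /\ g i = nx n.
  case: i {hij} => [|i]; first by exists 0%N.
  by exists (g i).+1; split=> // k hk; apply: gmon; exact: ltn_trans hk.
by rewrite hn2; apply: nx2; exact: hn1.
Qed.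

Lemma nondecreasing_mnm_subseq (f : nat -> 'X_{1..d}) :
  exists g : nat -> nat, (forall i j, (i < j)%N -> (g i < g j)%N) /\
    (forall i j, (i <= j)%N -> (f (g i) <= f (g j))%MM).
Proof.
suff h k : exists g : nat -> nat, (forall i j, (i < j)%N -> (g i < g j)%N) /\
    (forall c : 'I_d, (c < k)%N -> forall i j, (i <= j)%N -> (f (g i) c <= f (g j) c)%N).
  have [g [hg1 hg2]] := h d; exists g; split=> // i j hij.
  by apply/mnm_lepP => c; exact: hg2.
elim: k => [|k [g [hg1 hg2]]]; first by exists id.
have [hk|hk] := ltnP k d; last first.
  by exists g; split=> // c _; apply: hg2; exact: leq_trans (ltn_ord c) hk.
have [h [hh1 hh2]] := nondecreasing_subseq (fun i => f (g i) (Ordinal hk)).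
exists (g \o h); split=> [i j hij|c]; first by apply: hg1; exact: hh1.
rewrite ltnS leq_eqVlt => /orP[/eqP hc|hc] i j hij.
  have -> : c = Ordinal hk by exact: val_inj.
  exact: hh2.
apply: hg2 => //; move: hij; rewrite leq_eqVlt => /orP[/eqP -> //|hij].
by rewrite ltnW //; exact: hh1.
Qed.

(** If no finite subset sufficed, one could keep choosing exponents of [E] that lie above none of
    the earlier ones; a nondecreasing subsequence contradicts this. *)
Lemma dickson (E : 'X_{1..d} -> Prop) :
  exists s : seq 'X_{1..d}, (forall a, a \in s -> E a) /\
    (forall a, E a -> exists2 b, b \in s & (b <= a)%MM).
Proof.
apply: contrapT => hno.
have step (s : {s : seq 'X_{1..d} | forall a, a \in s -> E a}) :
    {a | E a /\ forall b, b \in sval s -> ~~ (b <= a)%MM}.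
  apply: cid; apply: contrapT => hs; apply: hno; exists (sval s); split; first by case: s {hs}.
  move=> a ha; apply: contrapT => hb; apply: hs; exists a; split=> // b hbs.
  by apply/negP => hba; apply: hb; exists b.
have stepE (s : {s : seq 'X_{1..d} | forall a, a \in s -> E a}) :
    forall a, a \in sval (step s) :: sval s -> E a.
  move=> a; rewrite inE => /orP[/eqP ->|]; last by case: (s) a.
  exact: (svalP (step s)).1.
have s0 : forall a, a \in ([::] : seq 'X_{1..d}) -> E a by [].
pose S := fix S n : {s : seq 'X_{1..d} | forall a, a \in s -> E a} :=
  if n is k.+1 then exist _ _ (stepE (S k)) else exist _ _ s0.
pose f n := sval (step (S n)).
have fin i j : (i < j)%N -> f i \in sval (S j).
  elim: j => // j IH; rewrite ltnS leq_eqVlt /= inE => /orP[/eqP ->|/IH ->].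
    by rewrite eqxx.
  by rewrite orbT.
have [g [hg1 hg2]] := nondecreasing_mnm_subseq f.
have := (svalP (step (S (g 1%N)))).2 (f (g 0%N)) (fin _ _ (hg1 0%N 1%N isT)).
by rewrite hg2.
Qed.
End Dickson.

(** * Polynomials with coefficients in an ideal *)

Section Coefficients.
Variables (F : fieldType) (d : nat) (A : set F).
Hypothesis hA : subring A.
Implicit Types (p q : {mpoly F[d]}) (I P : set F).

Definition coefs_in I p := forall g, I p@_g.

Lemma coefs_inD I p q : ideal A I -> coefs_in I p -> coefs_in I q -> coefs_in I (p + q).
Proof. by move=> hI hp hq g; rewrite mcoeffD; exact: (idD hI). Qed.
Lemma coefs_inB I p q : ideal A I -> coefs_in I p -> coefs_in I q -> coefs_in I (p - q).
Proof. by move=> hI hp hq g; rewrite mcoeffB; exact: (idB hA hI). Qed.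
Lemma coefs_inC I c : ideal A I -> I c -> coefs_in I c%:MP.
Proof.
move=> hI hc g; rewrite mcoeffC; case: eqP => _; first by rewrite mulr1.
by rewrite mulr0; exact: (id0 hI).
Qed.
Lemma coefs_inX m : coefs_in A 'X_[m].
Proof. by move=> g; rewrite mcoeffX; exact: sring_nat. Qed.
Lemma coefs_inM I p q : ideal A I -> coefs_in A p -> coefs_in I q -> coefs_in I (p * q).
Proof.
move=> hI hp hq g; rewrite mcoeffM; apply: (id_sum hI) => k _.
exact: (idM hI).
Qed.
Lemma coefs_inZ I c p : ideal A I -> A c -> coefs_in I p -> coefs_in I (c *: p).
Proof. by move=> hI hc hp g; rewrite mcoeffZ; exact: (idM hI). Qed.

Lemma coefs_in_eval I p (v : 'I_d -> F) : ideal A I -> (forall i, A (v i)) -> coefs_in I p ->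
  I p.@[v].
Proof.
move=> hI hv hp; rewrite mevalE; apply: (id_sum hI) => m _; apply: (idMr hI) => //.
by apply: (sring_prod hA) => i _; apply: (sringX hA).
Qed.

Lemma min_notin I p : ~ coefs_in I p ->
  exists2 a, ~ I p@_a & forall g, (g < a)%O -> I p@_g.
Proof.
move/existsNP => [b]; elim: (ltom_wf b) => {}b _ IH hb.
have [h|/existsNP [g /not_implyP [hg1 hg2]]] :=
  pselect (forall g, (g < b)%O -> I p@_g); first by exists b.
exact: IH hg1 hg2.
Qed.

(** Modulo [P] only the product of the two lowest coefficients contributes to the exponent [a + b]:
    in every other pair with this sum one exponent is below [a] or below [b]. *)
Lemma gauss P p q a b : prime_ideal A P -> coefs_in A p -> coefs_in A q ->
  ~ P p@_a -> (forall g, (g < a)%O -> P p@_g) ->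
  ~ P q@_b -> (forall g, (g < b)%O -> P q@_g) -> ~ P (p * q)@_(a + b).
Proof.
move=> [hP _ hprime] hp hq ha1 ha2 hb1 hb2.
have hab : ~ P (p@_a * q@_b) by case/hprime.
have da : (mdeg a < (mdeg (a + b)%MM).+1)%N by rewrite mdegD ltnS leq_addr.
have db : (mdeg b < (mdeg (a + b)%MM).+1)%N by rewrite mdegD ltnS leq_addl.
rewrite mcoeffM (bigD1 (BMultinom da, BMultinom db)) //= addrC => h; apply: hab.
apply: (id_addl hA hP _ h); apply: (id_sum hP) => -[[k1 h1] [k2 h2]] /= /andP[/eqP e hne].
have [lt|gt|eq] := ltgtP k1 a.
- by apply: (idMr hP) => //; exact: ha2.
- apply: (idM hP) => //; apply: hb2; rewrite -(ltmc_add2r a) e.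
  by rewrite ltmc_add2l.
- case/negP: hne; rewrite xpair_eqE !bmeqP /= eq eqxx.
  by move: e; rewrite eq => /addmI ->; rewrite eqxx.
Qed.

End Coefficients.

Section Local.
Variables (F : fieldType) (S M : set F) (d : nat) (x : 'I_d -> F).
Hypotheses (hS : subring S) (noeth : noetherian S) (locS : local_ring S M).
Hypothesis genM : M = ideal_span S (range x).
Implicit Types (p q : {mpoly F[d]}) (I J K P : set F).
Local Notation pow := (ideal_pow S M).

Let hM : ideal S M := local_ideal locS.

Hypothesis xM : forall i, M (x i).

Let xS i : S (x i). Proof. by apply: (idS hM); exact: xM. Qed.

Definition low r p := forall g, (mdeg g < r)%N -> p@_g = 0.

Lemma mon_pow (m : 'X_{1..d}) : pow (mdeg m) (\prod_i x i ^+ m i).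
Proof.
rewrite mdegE; apply: (big_ind2 (fun k y => pow k y)) => [|a b c e h1 h2|i _].
- exact: sring1.
- exact: (ideal_powD hS hM).
- by have := ideal_powX hS hM (m i) (ideal_pow1 hS (xM i)); rewrite mul1n.
Qed.

Lemma eval_pow k r p : coefs_in (pow k) p -> low r p -> pow (k + r) p.@[x].
Proof.
move=> hp hr; have hI := ideal_pow_ideal hS hM (k + r).
rewrite mevalE big_seq; apply: (id_sum hI) => m hm.
apply: (ideal_pow_le hS hM _ (ideal_powD hS hM (hp m) (mon_pow m))).
rewrite leq_add2l leqNgt; apply/negP => /hr /eqP.
by rewrite mcoeff_eq0 hm.
Qed.

Lemma homog_low r p : p \is r.-homog -> low r p.
Proof. by move=> hp g hg; apply: (dhomog_nemf_coeff hp); rewrite neq_ltn hg. Qed.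

Lemma pow_rep r z : pow r z -> exists p, [/\ coefs_in S p, p \is r.-homog & z = p.@[x]].
Proof.
elim: r z => [|r IH] z.
  move=> hz; exists z%:MP; split; [exact: (coefs_inC (ideal_self hS))| |by rewrite mevalC].
  by apply/dhomogP => m; rewrite msuppC; case: eqP => // _; rewrite inE => /eqP ->; exact: mdeg0.
pose K := [set z | exists p, [/\ coefs_in S p, p \is r.+1.-homog & z = p.@[x]]].
have hSS := ideal_self hS.
move: z; apply: (@ideal_mul_sub _ _ M (pow r) K).
  split.
  - by move=> _ [p [hp _ ->]]; exact: (coefs_in_eval hS hSS).
  - exists 0; split; [|exact: rpred0|by rewrite meval0].
    by move=> g; rewrite mcoeff0; exact: (sring0 hS).
  - move=> _ _ [p [hp hp' ->]] [q [hq hq' ->]]; exists (p + q).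
    by split; [exact: (coefs_inD hSS)|exact: rpredD|rewrite mevalD].
  - move=> c _ hc [p [hp hp' ->]]; exists (c *: p).
    by split; [exact: (coefs_inZ hSS)|exact: rpredZ|rewrite mevalZ].
move=> u v; rewrite {1}genM => /(span_range hS xS) [c hc ->] /IH [p [hp hp' ->]].
exists ((\sum_i c i *: 'X_i) * p); split.
- apply: (coefs_inM hSS) => // g; rewrite raddf_sum /=; apply: (sring_sum hS) => i _.
  by rewrite mcoeffZ; apply: (sringM hS) => //; exact: coefs_inX.
- rewrite -add1n; apply: dhomogM => //; apply: rpred_sum => i _; apply: rpredZ.
  by rewrite dhomogX; apply/eqP; exact: mdeg1.
- rewrite mevalM raddf_sum /=; congr (_ * _).
  by apply: eq_bigr => i _; rewrite mevalZ mevalXU.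
Qed.

Theorem krull_intersection K w : ideal S K -> S w ->
  (forall N, idealD K (pow N) w) -> K w.
Proof.
move=> hK hw hN; apply: contrapT => hKw.
have [J [[hJ hJw] hKJ hmax]] := @noetherian_max _ _ noeth (fun J => ideal S J /\ ~ J w) K
  (fun _ h => h.1) (conj hK hKw).
have hmax' y : S y -> ~ J y -> idealD J (principal S y) w.
  move=> hy hJy; apply: contrapT => hw'; apply: hJy.
  have hI := idealD_ideal hS hJ (principal_ideal hS hy).
  rewrite -(hmax (idealD J (principal S y))) //.
    by apply: (idealDr hJ); exact: (principal_self hS).
  by move=> z; exact: (idealDl (principal_ideal hS hy)).
have hMw z : M z -> J (z * w).
  move=> hz; apply: contrapT => hJz.
  have hzS := idS hM hz.
  have [|j [_ [hj [a ha ->] e]]] := hmax' _ _ hJz; first exact: (sringM hS).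
  apply: hJw.
  have haz : M (a * z) by exact: (idM hM).
  have -> : w = (1 - a * z)^-1 * j.
    apply: (mulfI (one_sub_neq0 locS haz)).
    rewrite mulVKf ?(one_sub_neq0 locS haz) //; apply: (addIr (a * (z * w))).
    by rewrite -e; ring.
  by apply: (idM hJ) => //; exact: (local_sub1 hS noeth locS).
have hnil z : M z -> exists n, J (z ^+ n).
  move=> hz; have hzS := idS hM hz.
  have hzX n : S (z ^+ n) by exact: (sringX hS).
  have hmono n : colon S J (z ^+ n) `<=` colon S J (z ^+ n.+1).
    by move=> a [ha1 ha2]; split=> //; rewrite exprS mulrCA; exact: (idM hJ).
  have [n hn] := noetherian_acc noeth (fun n => colon_ideal hS (hzX n) hJ) hmono.
  exists n; apply: contrapT => hJz.
  have [j [_ [hj [a ha ->] e]]] := hmax' _ (hzX n) hJz.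
  have h1 : colon S J (z ^+ n.+1) a.
    split=> //; have := hMw _ hz; rewrite e mulrDr => /(id_addl hS hJ (idM hJ hzS hj)).
    by rewrite exprS mulrCA.
  move: h1; rewrite hn => -[_ h2]; apply: hJw; rewrite e.
  exact: (idD hJ).
have /choice [n hn] : forall i, exists n, J (x i ^+ n) by move=> i; exact: hnil.
have hpow : pow (\sum_i (n i)).+1 `<=` J.
  move=> z /pow_rep [p [hp hh ->]]; rewrite mevalE big_seq.
  apply: (id_sum hJ) => m hm; apply: (idM hJ) => //.
  have hmd : mdeg m = (\sum_i (n i)).+1 by exact: (dhomog_mf hh).
  have [i hi] : exists i, (n i <= m i)%N.
    apply: contrapT => hno.
    have : (mdeg m <= \sum_i n i)%N.
      rewrite mdegE; apply: leq_sum => i _; rewrite leqNgt.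
      by apply/negP => /ltnW hi; apply: hno; exists i.
    by rewrite hmd ltnn.
  rewrite (bigD1 i) //= -(subnK hi) exprD -mulrA.
  apply: (idM hJ); first exact: (sringX hS).
  apply: (idMr hJ) => //; apply: (sring_prod hS) => j _; exact: (sringX hS).
exact: hJw (idealD_sub hJ hKJ hpow (hN _)).
Qed.

(* Exponents that are lowest for the degree-lexicographic order; coefficients in
   [M] count as zero. *)
Definition lead_set J : set 'X_{1..d} := [set a | exists p,
  [/\ coefs_in S p, low (mdeg a) p, forall g, (g < a)%O -> M p@_g, ~ M p@_a & J p.@[x]]].

Lemma lead_setS J J' : J `<=` J' -> lead_set J `<=` lead_set J'.
Proof. by move=> h a [p [h1 h2 h3 h4 h5]]; exists p; split=> //; exact: h. Qed.

Lemma lead_set_shift (J J' : set F) (a b : 'X_{1..d}) : lead_set J a ->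
  (forall z, J z -> J' (z * \prod_i x i ^+ b i)) -> lead_set J' (a + b)%MM.
Proof.
move=> [p [h1 h2 h3 h4 h5]] hJ; exists (p * 'X_[b]).
have hc g : (b <= g)%MM -> (p * 'X_[b])@_g = p@_(g - b).
  by move=> hg; rewrite -{1}(submK hg) addmC mcoeffMX.
have hc0 g : ~~ (b <= g)%MM -> (p * 'X_[b])@_g = 0.
  move=> hg; rewrite mcoeffM big1 // => -[k1 k2] /= /eqP e.
  rewrite mcoeffX; case: eqP => [ek|_]; last by rewrite mulr0.
  by case/negP: hg; rewrite [X in (_ <= X)%MM]e -ek lem_addl.
have hS' := ideal_self hS.
split.
- by rewrite mulrC; apply: (coefs_inM hS') => //; exact: coefs_inX.
- move=> g; have [hg|hg] := boolP (b <= g)%MM; last by rewrite hc0.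
  rewrite hc // -{1}(submK hg) !mdegD ltn_add2r; exact: h2.
- move=> g hlt; have [hg|hg] := boolP (b <= g)%MM; last by rewrite hc0 //; exact: (id0 hM).
  by rewrite hc //; apply: h3; move: hlt; rewrite -{1}(submK hg) ltmc_add2l.
- by rewrite addmC mcoeffMX.
- by rewrite mevalM mevalX; exact: hJ.
Qed.

(** Reduction within one degree. The lowest exponent [a] whose coefficient is outside [M] has degree
    [N] and is a leading exponent of [J'], hence of [J]. Subtracting a multiple of a witness for [J]
    kills the coefficient at [a] and keeps the lower ones in [M], so the lowest bad exponent moves
    up. When none of degree [N] is left, the value is in [M^(N+1)]. *)
Lemma division_step J J' N : ideal S J -> ideal S J' -> J `<=` J' ->
  (forall a, mdeg a = N -> lead_set J' a -> lead_set J a) ->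
  forall p, coefs_in S p -> low N p -> J' p.@[x] -> idealD J (pow N.+1) p.@[x].
Proof.
move=> hJ hJ' hJJ' hlead p.
have hpow := ideal_pow_ideal hS hM N.+1.
have hsum := idealD_ideal hS hJ hpow.
have hSS := ideal_self hS.
(* The induction measure: the number of exponents of degree at most [N] that are at least [a]. It
   counts [a] itself, so bound [0] leaves no bad exponent. *)
pose mu (a : 'X_{1..d}) := #|[pred g : 'X_{1..d < N.+1} | (a <= bmnm g)%O]|.
have [n hn] : exists n, forall a, (mdeg a <= N)%N -> ~ M p@_a -> (mu a <= n)%N.
  by exists #|{: 'X_{1..d < N.+1}}| => a _ _; exact: max_card.
elim: n p hn => [|n IH] p hn hp hlow hpJ.
all: have [hall|hnall] := pselect (forall a, (mdeg a <= N)%N -> M p@_a).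
1,3: apply: (idealDr hJ).
1,2: rewrite mevalE; apply: (id_sum hpow) => m _.
1,2: have [hm|hm] := leqP (mdeg m) N.
2,4: by apply: (idM hpow) => //; apply: (ideal_pow_le hS hM hm); exact: mon_pow.
1,2: have [hm'|hm'] := ltnP (mdeg m) N; first by rewrite hlow // mul0r; exact: (id0 hpow).
1,2: have em : mdeg m = N by apply/eqP; rewrite eqn_leq hm hm'.
1,2: by rewrite -em; apply: (ideal_powS) => //; [exact: hall|exact: mon_pow].
all: have [a ha1 ha2] : exists2 a, ~ M p@_a & forall g, (g < a)%O -> M p@_g
  by apply: min_notin => h; apply: hnall => a _; exact: h.
all: have had : (mdeg a <= N)%N
  by (rewrite leqNgt; apply/negP => hlt; apply: hnall => b hb;
    apply: ha2; apply: lt_mdeg_ltmc; exact: leq_ltn_trans hlt).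
all: have haN : mdeg a = N
  by (apply/eqP; rewrite eqn_leq had leqNgt; apply/negP => /hlow e;
    apply: ha1; rewrite e; exact: (id0 hM)).
  have := hn a had ha1; rewrite leqn0 => /eqP /card0_eq.
  have hb : (mdeg a < N.+1)%N by rewrite haN.
  by move/(_ (BMultinom hb)); rewrite !inE /= lexx.
have [q [hq1 hq2 hq3 hq4 hq5]] : lead_set J a.
  by apply: hlead => //; exists p; split=> //; rewrite haN.
pose c := p@_a / q@_a.
have hc : S c by apply: (sringM hS) => //; apply: (local_unit hS noeth locS).
have q0 : q@_a != 0 by apply/eqP => e; apply: hq4; rewrite e; exact: (id0 hM).
have -> : p.@[x] = (p - c *: q).@[x] + c * q.@[x] by rewrite mevalB mevalZ subrK.
have hcq : J (c * q.@[x]) by exact: (idM hJ).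
apply: (idD hsum); last exact: (idealDl hpow).
have hcoef g : (g <= a)%O -> M (p - c *: q)@_g.
  rewrite mcoeffB mcoeffZ le_eqVlt => /orP[/eqP ->|hg].
    by rewrite /c divfK // subrr; exact: (id0 hM).
  by apply: (idB hS hM); [exact: ha2|apply: (idM hM) => //; exact: hq3].
apply: IH.
- move=> b hb hbM.
  have hab : (a < b)%O by rewrite ltNge; apply/negP => /hcoef.
  rewrite -ltnS; apply: leq_trans (hn a had ha1).
  have ha' : (mdeg a < N.+1)%N by rewrite ltnS.
  apply: proper_card; apply/properP; split.
    by apply/fintype.subsetP => g; rewrite !inE; apply: le_trans; exact: ltW.
  by exists (BMultinom ha'); rewrite !inE /= ?lexx // -ltNge.
- by apply: (coefs_inB hS hSS) => //; exact: (coefs_inZ hSS).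
- by move=> g hg; rewrite mcoeffB mcoeffZ hlow // hq2 ?haN // mulr0 subrr.
- by rewrite mevalB mevalZ; apply: (idB hS hJ') => //; exact: hJJ'.
Qed.

Lemma division J J' n0 N : ideal S J -> ideal S J' -> J `<=` J' ->
  (forall a, (n0 <= mdeg a < N)%N -> lead_set J' a -> lead_set J a) ->
  J' `&` pow n0 `<=` idealD J (pow N).
Proof.
move=> hJ hJ' hJJ'; elim: N => [|N IH] hlead z [hz1 hz2].
  by apply: (idealDr hJ); apply: (ideal_pow_le hS hM (leq0n n0)).
have [hN|hN] := leqP N.+1 n0.
  by apply: (idealDr hJ); apply: (ideal_pow_le hS hM hN).
have hpow := ideal_pow_ideal hS hM N.+1.
have [j [y [hj hy e]]] : idealD J (pow N) z.
  by apply: IH => // a /andP[h1 h2]; apply: hlead; rewrite h1 ltnW.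
have [p [hp1 hp2 hp3]] := pow_rep hy.
rewrite e; apply: (idD (idealD_ideal hS hJ hpow)); first exact: (idealDl hpow).
rewrite hp3; apply: (division_step hJ hJ' hJJ') => //.
- by move=> a ha; apply: hlead; rewrite ha -ltnS hN ltnSn.
- exact: homog_low.
- by rewrite -hp3; apply: (id_addl hS hJ' (hJJ' _ hj)); rewrite -e.
Qed.

(* The leading exponents of elements of [P + yS] are generated by finitely many
   of them, which bounds uniformly the degree lost by division; this is the
   Artin-Rees lemma for the pair [(P, P + yS)]. *)
Lemma artin_rees P y : prime_ideal S P -> S y -> ~ P y ->
  exists c, forall n z, S z -> idealD P (pow (n + c)) (z * y) -> idealD P (pow n) z.
Proof.
move=> [hP _ hprime] hy hPy.
pose I := idealD P (principal S y).
have hI : ideal S I by apply: idealD_ideal => //; exact: principal_ideal.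
have [s [hs1 hs2]] := dickson (lead_set I).
pose c := \max_(a <- s) mdeg a.
exists c => n z hz hzy.
have hpow := ideal_pow_ideal hS hM n.
(* The target is the component of [z y] in [K = P + y M^n], from which [y] can be cancelled modulo
   the prime [P]. A leading exponent of [I] of degree at least [n + c] exceeds a generator by a
   monomial of degree at least [n]; multiplying by it moves [I] into [K]. *)
pose K := idealD P (scale_ideal y (pow n)).
have hyn := scale_ideal_ideal hS hy hpow.
have hK : ideal S K by exact: idealD_ideal.
have hKI : K `<=` I.
  by apply: idealD_mono => // _ [a ha ->]; exists a => //; exact: (idS hpow).
have [q [w [hq hw e]]] := hzy.
have hIw : I w.
  apply: (id_addl hS hI _ (x := q)); first exact: (idealDl (principal_ideal hS hy)).
  by rewrite -e; apply: (idealDr hP); exists z.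
have hKw : K w.
  apply: krull_intersection => //; first exact: (idS hI).
  move=> N; apply: (@division K I (n + c) N) => // a /andP[ha _] hIa.
  have [b hb hba] := hs2 a hIa.
  rewrite -(submK hba) addmC; apply: (lead_set_shift (hs1 _ hb)) => u.
  have hmon : pow n (\prod_i x i ^+ (a - b)%MM i).
    apply: (ideal_pow_le hS hM _ (mon_pow _)).
    have hbc : (mdeg b <= c)%N by rewrite /c (big_rem b) //= leq_maxl.
    move: ha; rewrite -{1}(submK hba) mdegD => ha.
    by rewrite -(leq_add2r (mdeg b)); apply: leq_trans ha; rewrite leq_add2l.
  have hmS := idS hpow hmon.
  move=> [u1 [_ [hu1 [a1 ha1 ->] ->]]].
  rewrite mulrDl; apply: (idD hK).
    by apply: (idealDl hyn); exact: (idMr hP).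
  apply: (idealDr hP); exists (a1 * \prod_i x i ^+ (a - b)%MM i); last by ring.
  exact: (idM hpow).
have [q' [_ [hq' [h hh ->] e']]] := hKw.
have hhS := idS hpow hh.
exists (z - h), h; split=> //; last by rewrite subrK.
have hzh : S (z - h) by exact: (sringB hS).
have : P ((z - h) * y).
  rewrite mulrBl e e' addrA addrK; exact: (idD hP).
by case/hprime.
Qed.

End Local.

(** * Dimension and regular parameters *)

Section IdealChains.
Variables (F : fieldType) (S : set F).
Hypothesis hS : subring S.

(** The supremum of such [k] is the length of [S/I]. *)
Definition ideal_chain (I : set F) k := exists J : nat -> set F,
  [/\ forall i, (i <= k)%N -> ideal S (J i), I `<=` J 0%N
    & forall i, (i < k)%N -> J i `<` J i.+1].

Lemma ideal_chainS (I I' : set F) k : I `<=` I' -> ideal_chain I' k -> ideal_chain I k.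
Proof. by move=> h [J [h1 h2 h3]]; exists J; split=> // z hz; apply: h2; exact: h. Qed.

Lemma ideal_chain0 I : ideal S I -> ideal_chain I 0.
Proof. by move=> h; exists (fun=> I); split. Qed.

(** One inequality of the additivity of length along [0 -> S/(I : y) -> S/I -> S/(I + yS) -> 0],
    whose first map is multiplication by [y]. The chain above [I : y] is transported to the ideals
    [I + y J_i], and the chain above [I + yS] is appended. *)
Lemma ideal_chain_colon I y j k : ideal S I -> S y ->
  ideal_chain (colon S I y) j -> ideal_chain (idealD I (principal S y)) k ->
  ideal_chain I (j + k).
Proof.
move=> hI hy [J [hJ1 hJ2 hJ3]] [K [hK1 hK2 hK3]].
have hJy i : (i <= j)%N -> ideal S (scale_ideal y (J i)).
  by move=> hi; apply: scale_ideal_ideal => //; exact: hJ1.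
have hJ0 i : (i <= j)%N -> J 0%N `<=` J i.
  elim: i => [_ //|i IH hi z hz].
  by apply: (properW (hJ3 _ hi)); exact: IH (ltnW hi) _ hz.
pose L i := if (i < j)%N then idealD I (scale_ideal y (J i)) else K (i - j)%N.
have hlt i : (i < j)%N ->
    idealD I (scale_ideal y (J i)) `<` idealD I (scale_ideal y (J i.+1)).
  move=> hi; have [h1 h2] := hJ3 _ hi; split.
    by apply: idealD_mono => // _ [a ha ->]; exists a => //; exact: h1.
  move=> h3; apply: h2 => z hz.
  have [u [_ [hu [a ha ->] e]]] : idealD I (scale_ideal y (J i)) (z * y).
    by apply: h3; apply: (idealDr hI); exists z.
  have hzS : S z by exact: (idS (hJ1 _ hi)).
  have haS : S a by exact: (idS (hJ1 _ (ltnW hi))).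
  rewrite -(subrK a z); apply: (idD (hJ1 _ (ltnW hi))) => //.
  apply: (hJ0 _ (ltnW hi)); apply: hJ2; split; first exact: (sringB hS).
  by rewrite mulrBl e addrK.
exists L; split.
- move=> i hi; rewrite /L; case: ifP => hij.
    by apply: idealD_ideal => //; apply: hJy; exact: ltnW.
  by apply: hK1; rewrite leq_subLR.
- rewrite /L; case: ifP => h0.
    by apply: idealDl; exact: hJy.
  rewrite sub0n => z hz; apply: hK2; apply: idealDl hz; exact: principal_ideal.
- move=> i hi; rewrite /L.
  have [h1|h1] := ltnP i.+1 j; first by rewrite (ltnW h1); exact: hlt (ltnW h1).
  case: ifP => h2.
    have -> : (i.+1 - j = 0)%N by apply/eqP; rewrite subn_eq0.
    have hsub : idealD I (scale_ideal y (J i.+1)) `<=` K 0%N.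
      move=> z hz; apply: hK2; apply: idealD_mono hz => // _ [a ha ->].
      by exists a => //; exact: (idS (hJ1 _ h2)).
    have [hlt1 hlt2] := hlt _ h2; split=> [z /hlt1|hK]; first exact: hsub.
    by apply: hlt2 => z /hsub /hK.
  have hji : (j <= i)%N by rewrite leqNgt h2.
  by rewrite subSn //; apply: hK3; rewrite ltn_subLR.
Qed.
End IdealChains.

Lemma card_ffun_lt (d N b : nat) (i : 'I_d) :
  (#|[pred f : {ffun 'I_d -> 'I_N} | (f i < b)%N]| <= b * N ^ d.-1)%N.
Proof.
pose G (j : 'I_d) : pred 'I_N := if j == i then [pred v : 'I_N | (v < b)%N] else predT.
have -> : #|[pred f : {ffun 'I_d -> 'I_N} | (f i < b)%N]| =
          #|(family G : pred {ffun 'I_d -> 'I_N})|.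
  apply: eq_card => f; rewrite !inE; apply/idP/familyP => [h j|/(_ i)].
    by rewrite /G; case: eqP => [->|].
  by rewrite /G eqxx.
rewrite card_family foldrE big_image /= (bigD1 i) //=; apply: leq_mul.
  rewrite /G eqxx; have [hN|hN] := leqP N b.
    by apply: leq_trans (max_card _) _; rewrite card_ord.
  have inj : injective (widen_ord (ltnW hN)) by move=> u v /(congr1 val) /= /val_inj.
  rewrite -[X in (_ <= X)%N](card_ord b) -(fintype.card_image inj).
  apply: subset_leq_card; apply/fintype.subsetP => v; rewrite inE => hv.
  by apply/fintype.imageP; exists (Ordinal hv) => //; exact: val_inj.
rewrite (eq_bigr (fun=> N)); last first.
  by move=> j /negPf hj; rewrite /G hj card_ord.
by rewrite prod_nat_const cardC1 card_ord.
Qed.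

Section Dimension.
Variables (F : fieldType) (S M : set F) (d : nat) (x : 'I_d -> F).
Hypotheses (hS : subring S) (noeth : noetherian S) (locS : local_ring S M).
Hypotheses (genM : M = ideal_span S (range x)) (xM : forall i, M (x i)).
Implicit Types (p q : {mpoly F[d]}) (I J K P : set F).
Local Notation pow := (ideal_pow S M).
Local Notation lead := (lead_set S M x).

Let hM : ideal S M := local_ideal locS.

Lemma zero_ideal : ideal S [set 0].
Proof.
split=> //.
- by move=> _ ->; exact: sring0.
- by move=> a b -> ->; rewrite addr0.
- by move=> a b _ ->; rewrite mulr0.
Qed.

(** If all leading exponents of [J] in degrees below [N] came from [I], division would give [J]
    inside [I + M^N = I]. *)
Lemma lead_set_proper I J N : ideal S I -> ideal S J -> pow N `<=` I -> I `<` J ->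
  exists a, [/\ (mdeg a < N)%N, lead J a & ~ lead I a].
Proof.
move=> hI hJ hN [hIJ hne]; apply: contrapT => hno; apply: hne => z hz.
have hlead a : (0 <= mdeg a < N)%N -> lead J a -> lead I a.
  by move=> /= ha hJa; apply: contrapT => hIa; apply: hno; exists a.
have [y [w [hy hw ->]]] :=
  division hS noeth locS genM xM hI hJ hIJ hlead (conj hz (idS hJ hz)).
by apply: (idD hI) => //; exact: hN.
Qed.

(* If [0] has a leading exponent [a0], every leading-exponent set contains
   [a0 + N^d], so at most [C N^(d-1)] exponents below [N] are left for a strictly
   increasing sequence of such sets. *)
Lemma chain_bound a0 : lead [set 0] a0 ->
  exists C, forall N I k, pow N `<=` I -> ideal_chain S I k -> (k <= C * N ^ d.-1)%N.
Proof.
move=> ha0; exists (\sum_i a0 i)%N => N I k hN [J [hJ1 hJ2 hJ3]].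
pose mn (f : {ffun 'I_d -> 'I_N}) : 'X_{1..d} := [multinom val (f i) | i < d].
pose T i := [pred f : {ffun 'I_d -> 'I_N} | `[< lead (J i) (mn f) >]].
have hNJ i : (i <= k)%N -> pow N `<=` J i.
  elim: i => [_|i IH hi z hz]; first by move=> z hz; apply: hJ2; exact: hN.
  by apply: (properW (hJ3 _ hi)); exact: IH (ltnW hi) _ hz.
have hstep i : (i < k)%N -> (#|T i| < #|T i.+1|)%N.
  move=> hi; have [hlt _] := hJ3 _ hi; apply: proper_card; apply/properP; split.
    by apply/fintype.subsetP => f /asboolP h; apply/asboolP; exact: lead_setS h.
  have [a [ha1 ha2 ha3]] := lead_set_proper (hJ1 _ (ltnW hi)) (hJ1 _ hi)
    (hNJ _ (ltnW hi)) (hJ3 _ hi).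
  have hai i' : (a i' < N)%N.
    by apply: leq_ltn_trans ha1; rewrite mdegE (bigD1 i') //= leq_addr.
  have e : mn [ffun i' => Ordinal (hai i')] = a.
    by apply/mnmP => i'; rewrite mnmE ffunE.
  exists [ffun i' => Ordinal (hai i')]; first by apply/asboolP; rewrite e.
  by apply/negP => /asboolP; rewrite e.
have hk i : (i <= k)%N -> (#|T 0%N| + i <= #|T i|)%N.
  elim: i => [|i IH] hi; first by rewrite addn0.
  by rewrite addnS; apply: leq_ltn_trans (IH (ltnW hi)) (hstep _ hi).
have h0 f : (a0 <= mn f)%MM -> T 0%N f.
  move=> h; apply/asboolP; rewrite -(submK h) addmC.
  apply: (lead_set_shift hS locS ha0) => z ->; rewrite mul0r.
  exact: (id0 (hJ1 0%N (leq0n k))).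
have : (k <= #|[predC T 0%N]|)%N.
  rewrite -(leq_add2l #|T 0%N|) cardC.
  exact: leq_trans (hk k (leqnn k)) (max_card _).
move/leq_trans; apply.
have hsub : {subset [predC T 0%N] <= [pred f : {ffun 'I_d -> 'I_N} | [exists i, (f i < a0 i)%N]]}.
  move=> f hf; change (is_true [exists i, (f i < a0 i)%N]).
  apply/existsP; apply: contrapT => hn.
  case/negP: hf; apply: h0; apply/mnm_lepP => i; rewrite mnmE leqNgt.
  by apply/negP => hi; apply: hn; exists i.
apply: leq_trans (subset_leq_card (introT (fintype.subsetP) hsub)) _.
rewrite big_distrl /=.
apply: leq_trans (_ : \sum_i #|[pred f : {ffun 'I_d -> 'I_N} | (f i < a0 i)%N]| <= _)%N.
  have hE (P : pred {ffun 'I_d -> 'I_N}) : #|P| = (\sum_f P f)%N.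
    by rewrite -sum1_card big_mkcond.
  rewrite hE (eq_bigr (fun i => \sum_(f : {ffun 'I_d -> 'I_N}) (f i < a0 i)%N)%N); last by move=> i _; rewrite hE.
  rewrite exchange_big /=; apply: leq_sum => f _.
  by case: existsP => // -[i hi]; rewrite (bigD1 i) //= hi.
by apply: leq_sum => i _; exact: card_ffun_lt.
Qed.

(** The length of [S/(P + M^N)] is [O(N^D)]: an upper bound for the degree of the Hilbert-Samuel
    function of [S/P]. *)
Definition growth P D := exists C, forall N k, (0 < N)%N ->
  ideal_chain S (idealD P (pow N)) k -> (k <= C * N ^ D)%N.

(* Artin-Rees turns a chain of length [k] above [P' + m^N] into chains of length
   [i k] above [P + m^(N + i c)]; take [i = N]. *)
Lemma growth_step P P' D : prime_ideal S P -> ideal S P' -> P `<` P' ->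
  growth P D.+1 -> growth P' D.
Proof.
move=> hPp hP' [hPP' hne] [C hC].
have [hP _ _] := hPp.
have [y hy hPy] : exists2 y, P' y & ~ P y.
  by apply: contrapT => hno; apply: hne => y hy; apply: contrapT => h; apply: hno; exists y.
have hyS := idS hP' hy.
have [c hc] := artin_rees hS noeth locS genM xM hPp hyS hPy.
exists (C * c.+1 ^ D.+1)%N => N k hN hk.
have hpow n := ideal_pow_ideal hS hM n.
have hI n : ideal S (idealD P (pow n)) by exact: idealD_ideal.
have hchain i : ideal_chain S (idealD P (pow (N + i * c))) (i * k).
  elim: i => [|i IH]; first by rewrite mul0n addn0; exact: ideal_chain0.
  rewrite mulSnr mulSnr addnA; apply: (ideal_chain_colon hS _ hyS) => //.
    by apply: (ideal_chainS _ IH) => z [hz1 hz2]; exact: hc hz1 hz2.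
  apply: (ideal_chainS _ hk); apply: (@idealD_sub _ S); first exact: idealD_ideal.
    apply: idealD_mono => //; apply: (ideal_pow_le hS hM).
    by rewrite -addnA leq_addr.
  by move=> _ [a ha ->]; apply: (idealDl (hpow N)); exact: (idM hP').
have h : (N * k <= C * (N + N * c) ^ D.+1)%N.
  by apply: hC (hchain N); rewrite addn_gt0 hN.
rewrite -mulnS expnMn in h.
by rewrite -(leq_pmul2l hN); apply: leq_trans h _; rewrite expnS; apply: eq_leq; ring.
Qed.

(** After [d - 1] steps the growth has degree [0], so [S/(P + M^N)] has bounded length for
    [P = p (d - 1)]. As [P] is strictly below the prime [p d], it is not the maximal ideal, and the
    ideals [P + M^N] decrease strictly forever. *)
Theorem dimension_lead_set (p : nat -> set F) : (0 < d)%N -> prime_chain S d p ->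
  forall a, ~ lead [set 0] a.
Proof.
move=> hd [hp1 hp2] a ha.
have [C hC] := chain_bound ha.
have hpow n := ideal_pow_ideal hS hM n.
have hg i : (i < d)%N -> growth (p i) (d.-1 - i).
  elim: i => [|i IH] hi.
    rewrite subn0; exists C => N k hN; apply: hC; apply: (@idealDr _ S).
    by have [] := hp1 0%N (leq0n d).
  have [hpi _ _] := hp1 i.+1 (ltnW hi).
  apply: (growth_step (hp1 i _) hpi (hp2 i _)); [exact: ltnW (ltnW hi)|exact: ltnW|].
  have -> : ((d.-1 - i.+1).+1 = d.-1 - i)%N by lia.
  exact: IH (ltnW hi).
have hd1 : (d.-1 < d)%N by rewrite ltn_predL.
have [K] := hg _ hd1; rewrite subnn => hK.
set P := p d.-1 in hK.
have hPp : prime_ideal S P by apply: hp1; exact: ltnW.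
have [hP _ hprime] := hPp.
have [hpd hpd1 _] := hp1 d (leqnn d).
have hI n : ideal S (idealD P (pow n)) by exact: idealD_ideal.
(* A stationary step would propagate to [M^n] inside [P + M^k] for all [k], hence inside [P] by
   Krull's intersection theorem, and [P] would contain [M]. *)
have hnak n : ~ pow n `<=` idealD P (pow n.+1).
  move=> h.
  have hmul i k : pow i `<=` idealD P (pow k) -> pow i.+1 `<=` idealD P (pow k.+1).
    move=> hik; apply: ideal_mul_sub => // u v hu /hik [a1 [b1 [ha1 hb1 ->]]].
    rewrite mulrDr; apply: (idD (hI _)).
      by apply: (idealDl (hpow _)); apply: (idM hP) => //; exact: (idS hM).
    by apply: (idealDr hP); exact: ideal_powS.
  have hn i : pow n `<=` idealD P (pow (n + i)).
    elim: i => [|i IH]; first by rewrite addn0; exact: (idealDr hP).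
    have h1 : pow (n + i) `<=` idealD P (pow (n + i.+1)).
      rewrite addnS; elim: (i) => [|i' IH']; first by rewrite addn0.
      by rewrite addnS; exact: hmul.
    by move=> z /IH; apply: (@idealD_sub _ S) => //; exact: (idealDl (hpow _)).
  have hnP : pow n `<=` P.
    move=> z hz; apply: (krull_intersection hS noeth locS genM xM hP).
      exact: (idS (hpow n)).
    move=> N; have := hn N z hz; apply: idealD_mono => //.
    by apply: (ideal_pow_le hS hM); exact: leq_addl.
  have hMP : M `<=` P.
    move=> z hz; have hzS := idS hM hz.
    have : P (z ^+ n).
      by apply: hnP; have := ideal_powX hS hM n (ideal_pow1 hS hz); rewrite mul1n.
    elim: (n) => [|i IH]; first by rewrite expr0 => h1; case: hPp.
    by rewrite exprS => /hprime [] //; exact: (sringX hS).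
  have := hp2 _ hd1; rewrite prednK // => -[_]; apply.
  by move=> z /(local_proper_sub hS noeth locS hpd hpd1); exact: hMP.
have := hK K.+1 K.+1 (ltn0Sn K); rewrite expn0 muln1 ltnn => hlt.
suff /hlt : ideal_chain S (idealD P (pow K.+1)) K.+1 by [].
exists (fun i => idealD P (pow (K.+1 - i))); split=> //.
move=> i hi; rewrite subSS subSn //; split.
  by apply: idealD_mono => //; exact: (ideal_pow_sub hS hM).
move=> h; apply: (hnak (K - i)%N) => z hz; exact: (h _ (idealDr hP hz)).
Qed.

Hypothesis regular : forall a, ~ lead [set 0] a.

(** Write the value of [p] also as that of a form [q] of degree [r + 1]. Then [p - q] vanishes at
    [x], and [q] does not touch exponents of degree at most [r]; a coefficient of [p] outside [M]
    would make a leading exponent of the zero ideal. *)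
Lemma quasi_regular r p : coefs_in S p -> p \is r.-homog -> pow r.+1 p.@[x] -> coefs_in M p.
Proof.
move=> hp hh hx; apply: contrapT => /min_notin [a ha1 ha2].
have [q [hq1 hq2 hq3]] := pow_rep hS locS genM xM hx.
have har : mdeg a = r.
  apply/eqP; apply: contrapT => /negP h; apply: ha1.
  by rewrite (dhomog_nemf_coeff hh h); exact: (id0 hM).
have q0 g : (mdeg g <= r)%N -> q@_g = 0.
  by move=> hg; apply: (dhomog_nemf_coeff hq2); rewrite neq_ltn ltnS hg.
apply: (regular (a := a)); exists (p - q); split.
- by apply: (coefs_inB hS) => //; exact: ideal_self.
- by move=> g; rewrite har => hg; rewrite mcoeffB (homog_low hh) // q0 ?subr0 // ltnW.
- move=> g hg; rewrite mcoeffB q0 ?subr0; first exact: ha2.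
  by rewrite -har; apply: lemc_mdeg; exact: ltW.
- by rewrite mcoeffB q0 ?har // subr0.
- by rewrite /= mevalB hq3 subrr.
Qed.

Lemma order_exists z : S z -> z != 0 -> exists r, pow r z /\ ~ pow r.+1 z.
Proof.
move=> hz z0.
have [N hN] : exists N, ~ pow N z.
  apply: contrapT => hno; case/eqP: z0.
  apply: (krull_intersection hS noeth locS genM xM zero_ideal) => // N.
  apply: (idealDr zero_ideal).
  by apply: contrapT => h; apply: hno; exists N.
elim: N hN => [//|N IH] hN.
have [h|h] := pselect (pow N z); [by exists N|exact: IH].
Qed.

(** The associated graded ring is a domain: Gauss's lemma modulo [M], applied to homogeneous
    representatives of [a] and [b]. *)
Lemma mul_notin_pow r s a b : pow r a -> ~ pow r.+1 a -> pow s b -> ~ pow s.+1 b ->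
  ~ pow (r + s).+1 (a * b).
Proof.
move=> ha ha' hb hb' hab.
have [p [hp hph ep]] := pow_rep hS locS genM xM ha.
have [q [hq hqh eq]] := pow_rep hS locS genM xM hb.
have notM t (u : {mpoly F[d]}) : coefs_in S u -> u \is t.-homog ->
    ~ pow t.+1 u.@[x] -> ~ coefs_in M u.
  move=> hu hut hn hM'; apply: hn; rewrite -add1n.
  by apply: (eval_pow hS locS xM); [rewrite (ideal_pow1E hS hM)|exact: homog_low].
rewrite ep in ha' hab; rewrite eq in hb' hab.
have [al ha1 ha2] := min_notin (notM _ _ hp hph ha').
have [be hb1 hb2] := min_notin (notM _ _ hq hqh hb').
apply: (gauss hS (local_prime_ideal hS noeth locS) hp hq ha1 ha2 hb1 hb2).
apply: (@quasi_regular (r + s)).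
- exact: (coefs_inM (ideal_self hS)).
- exact: dhomogM.
- by rewrite mevalM.
Qed.

End Dimension.

Section RegularSystem.
Variables (F : fieldType) (S M : set F).
Hypothesis reg : regular_local_ring S M.

(** The chart divides by [x0], so [x0] should be one of the parameters. As [x0] is not in [M^2],
    some coefficient of [x0] in the given generators is a unit, and the corresponding generator can
    be exchanged for [x0]. *)
Lemma regular_parameters x0 : M x0 -> ~ ideal_pow S M 2 x0 ->
  exists d (x : 'I_d -> F) j, [/\ x j = x0, M = ideal_span S (range x),
    forall i, M (x i) & forall a, ~ lead_set S M x [set 0] a].
Proof.
move=> hx0 hx02; case: reg => hS noeth locS [d [[p hp] _] [s hsz hs]].
have hM := local_ideal locS.
pose y (i : 'I_d) := s`_i.
have hys : range y = [set` s].
  apply/seteqP; split=> [_ [i _ <-]|z /=].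
    by rewrite /y /=; apply: mem_nth; rewrite hsz.
  move/(nthP 0) => [i hi <-]; rewrite hsz in hi.
  by exists (Ordinal hi).
rewrite -hys in hs.
(* If a generator were outside [S], no ideal of [S] would contain them all, and [ideal_span] would
   be an empty intersection, that is, all of [F]. *)
have hyS : range y `<=` S.
  apply: contrapT => hno; apply: (local_n1 locS); rewrite hs => J [hJ hJy].
  by case: hno; apply: subset_trans hJy _; exact: (idS hJ).
have yM i : M (y i) by rewrite hs; apply: sub_ideal_span; exists i.
have yS i : S (y i) by exact: (idS hM).
have := hx0; rewrite {1}hs => /(span_range hS yS) [c hc ec].
have [j hj] : exists j, ~ M (c j).
  apply: contrapT => hno; apply: hx02; rewrite ec.
  apply: (id_sum (ideal_pow_ideal hS hM 2)) => i _.
  apply: ideal_powS; last exact: ideal_pow1.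
  by apply: contrapT => h; apply: hno; exists i.
pose x i := if i == j then x0 else y i.
have xM i : M (x i) by rewrite /x; case: ifP.
have xS i : S (x i) by exact: (idS hM).
have hspan : ideal S (ideal_span S (range x)).
  by apply: (ideal_span_ideal hS) => _ [i _ <-].
have hxM : M = ideal_span S (range x).
  apply/seteqP; split; last by apply: ideal_span_sub => // _ [i _ <-].
  rewrite {1}hs; apply: ideal_span_sub => // _ [i _ <-].
  have hx i' : ideal_span S (range x) (x i') by apply: sub_ideal_span; exists i'.
  have [->|hij] := eqVneq i j; last by have := hx i; rewrite /x (negPf hij).
  have cj0 : c j != 0 by apply/eqP => e; apply: hj; rewrite e; exact: (id0 hM).
  have -> : y j = (c j)^-1 * (x j - \sum_(i | i != j) c i * x i).
    apply: (mulfI cj0); rewrite mulVKf // {1}/x eqxx ec (bigD1 j) //=.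
    rewrite [X in _ - X](eq_bigr (fun i => c i * y i)) ?addrK //.
    by move=> k /negPf hk; rewrite /x hk.
  apply: (idM hspan); first exact: (local_unit hS noeth locS).
  apply: (idB hS hspan) => //; apply: (id_sum hspan) => k _.
  exact: (idM hspan).
exists d, x, j; split=> //; first by rewrite /x eqxx.
apply: (dimension_lead_set hS noeth locS hxM xM _ hp).
exact: leq_ltn_trans (leq0n j) (ltn_ord j).
Qed.
End RegularSystem.

(** * Local quadratic transforms *)

Section BlowupChart.
Variables (F : fieldType) (S M : set F) (x0 : F).
Hypotheses (hS : subring S) (hM : ideal S M) (Mx0 : M x0) (nx0 : x0 != 0).
Local Notation pow := (ideal_pow S M).
Local Notation B := (blowup_chart S M x0).

Let hpow n := ideal_pow_ideal hS hM n.
Let powX0 n : pow n (x0 ^+ n).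
Proof. by have := ideal_powX hS hM n (ideal_pow1 hS Mx0); rewrite mul1n. Qed.

Lemma blowup_chartP z : B z <-> exists r a, pow r a /\ z = a / x0 ^+ r.
Proof.
split=> [|[r [a [ha ->]]] T [/subringP [T1 TB TM] hT]].
  pose K := [set z | exists r a, pow r a /\ z = a / x0 ^+ r].
  move=> hz; apply: (hz K); split.
    apply/subringP; split.
    - by exists 0%N, 1; rewrite expr0 divr1; split=> //; exact: (sring1 hS).
    - move=> _ _ [r [a [ha ->]]] [s [b [hb ->]]].
      exists (r + s)%N, (a * x0 ^+ s - x0 ^+ r * b); split.
        by apply: (idB hS (hpow _)); exact: (ideal_powD hS hM).
      by rewrite exprD; field; rewrite !expf_neq0.
    - move=> _ _ [r [a [ha ->]]] [s [b [hb ->]]].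
      exists (r + s)%N, (a * b); split; first exact: (ideal_powD hS hM).
      by rewrite exprD; field; rewrite !expf_neq0.
  move=> y [hy|[y' hy' <-]]; first by exists 0%N, y; rewrite expr0 divr1.
  by exists 1%N, y'; rewrite expr1; split=> //; exact: ideal_pow1.
have hT' : subring T by apply/subringP.
have hS' y : S y -> T y by move=> hy; apply: hT; left.
elim: r a ha => [|r IH] a ha; first by rewrite expr0 divr1; exact: hS'.
pose K := [set a | S a /\ T (a / x0 ^+ r.+1)].
suff h : pow r.+1 `<=` K by case: (h _ ha).
apply: ideal_mul_sub.
  split.
  - by move=> y [].
  - by split; [exact: (sring0 hS)|rewrite mul0r; exact: (sring0 hT')].
  - by move=> u v [u1 u2] [v1 v2]; split; [exact: (sringD hS)|rewrite mulrDl; exact: (sringD hT')].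
  - move=> c u hc [u1 u2]; split; first exact: (sringM hS).
    by rewrite -mulrA; apply: TM => //; exact: hS'.
move=> u v hu hv; split.
  by apply: (sringM hS); [exact: (idS hM)|exact: (idS (hpow r))].
have -> : u * v / x0 ^+ r.+1 = (u / x0) * (v / x0 ^+ r).
  by rewrite exprS; field; rewrite nx0 expf_neq0.
by apply: TM; [apply: hT; right; exists u|exact: IH].
Qed.

Lemma blowup_chart_subring : subring B.
Proof.
apply/subringP; split=> [T [hT _]|a b ha hb T hT|a b ha hb T hT].
- exact: (sring1 hT).
- by apply: (sringB hT.1); [exact: ha|exact: hb].
- by apply: (sringM hT.1); [exact: ha|exact: hb].
Qed.

Lemma sub_blowup_chart : S `<=` B.
Proof. by move=> y hy T [_]; apply; left. Qed.

Lemma blowup_chart_spanP z : ideal_span B M z <-> exists r a, pow r.+1 a /\ z = a / x0 ^+ r.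
Proof.
have hB := blowup_chart_subring.
have hMB : M `<=` B by move=> y hy; apply: sub_blowup_chart; exact: (idS hM).
have hI := ideal_span_ideal hB hMB.
split=> [|[r [a [ha ->]]]]; last first.
  have -> : a / x0 ^+ r = (a / x0 ^+ r.+1) * x0.
    by rewrite exprS; field; rewrite nx0 expf_neq0.
  by apply: (idM hI); [apply/blowup_chartP; exists r.+1, a|exact: sub_ideal_span].
pose K := [set z | exists r a, pow r.+1 a /\ z = a / x0 ^+ r].
move: z; apply: (@ideal_span_sub _ B M K).
  split.
  - move=> _ [r [a [ha ->]]]; apply/blowup_chartP; exists r, a; split=> //.
    exact: (ideal_pow_sub hS hM).
  - by exists 0%N, 0; rewrite mul0r; split=> //; exact: (id0 (hpow 1)).
  - move=> _ _ [r [a [ha ->]]] [s [b [hb ->]]].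
    exists (r + s)%N, (a * x0 ^+ s + x0 ^+ r * b); split.
      apply: (idD (hpow _)); first by rewrite -addSn; exact: (ideal_powD hS hM).
      by rewrite -addnS; exact: (ideal_powD hS hM).
    by rewrite exprD; field; rewrite !expf_neq0.
  - move=> c _ /blowup_chartP [r [a [ha ->]]] [s [b [hb ->]]].
    exists (r + s)%N, (a * b); split; first by rewrite -addnS; exact: (ideal_powD hS hM).
    by rewrite exprD; field; rewrite !expf_neq0.
move=> y hy; exists 0%N, y; rewrite expr0 divr1; split=> //; exact: ideal_pow1.
Qed.

Hypothesis mul_notin : forall r s a b, pow r a -> ~ pow r.+1 a -> pow s b -> ~ pow s.+1 b ->
  ~ pow (r + s).+1 (a * b).
Hypothesis x02 : ~ pow 2 x0.

Lemma expX0_notin n : ~ pow n.+1 (x0 ^+ n).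
Proof.
elim: n => [|n IH]; last first.
  by rewrite exprS; apply: (@mul_notin 1 n) => //; exact: ideal_pow1.
move=> h; apply: x02; rewrite -(mulr1 x0); exact: ideal_powS.
Qed.

(** The right-hand side no longer mentions [x0]; this is how order valuation rings given by
    different elements of [M] outside [M^2] are identified. *)
Lemma order_localizationP z : localization B (ideal_span B M) z <->
  exists r a b, [/\ pow r a, pow r b, ~ pow r.+1 b & z = a / b].
Proof.
split=> [[_ [_ [/blowup_chartP [r [a [ha ->]]] /blowup_chartP [s [b [hb ->]]] hn ->]]]|].
  have hb' : ~ pow s.+1 b by move=> h; apply: hn; apply/blowup_chart_spanP; exists s, b.
  exists (r + s)%N, (a * x0 ^+ s), (x0 ^+ r * b); split.
  - exact: (ideal_powD hS hM).
  - exact: (ideal_powD hS hM).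
  - by apply: mul_notin => //; exact: expX0_notin.
  - have [->|b0] := eqVneq b 0; first by rewrite mulr0 mul0r !invr0 !mulr0.
    by field; rewrite b0 !expf_neq0.
move=> [r [a [b [ha hb hb' ->]]]]; exists (a / x0 ^+ r), (b / x0 ^+ r); split.
- by apply/blowup_chartP; exists r, a.
- by apply/blowup_chartP; exists r, b.
- move=> /blowup_chart_spanP [s [c [hc e]]].
  apply: (@mul_notin s r (x0 ^+ s) b) => //; first exact: expX0_notin.
  have -> : x0 ^+ s * b = c * x0 ^+ r.
    have -> : b = (b / x0 ^+ r) * x0 ^+ r by rewrite divfK ?expf_neq0.
    by rewrite e; field; rewrite !expf_neq0.
  by rewrite -addSn; exact: (ideal_powD hS hM).
- have [->|b0] := eqVneq b 0; first by rewrite mul0r !invr0 !mulr0.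
  by field; rewrite b0 !expf_neq0.
Qed.

End BlowupChart.

Section Localization.
Variables (F : fieldType) (B P : set F).
Hypotheses (hB : subring B) (hP : prime_ideal B P).

Lemma localization_subring : subring (localization B P).
Proof.
have [hPi hP1 hprime] := hP.
have nz s : ~ P s -> s != 0 by move=> h; apply/eqP => e; apply: h; rewrite e; exact: (id0 hPi).
have hmul s t : B s -> B t -> ~ P s -> ~ P t -> ~ P (s * t).
  by move=> h1 h2 h3 h4 /hprime [].
apply/subringP; split.
- by exists 1, 1; rewrite divr1; split=> //; exact: (sring1 hB).
- move=> _ _ [a [s [ha hs hPs ->]]] [b [t [hb ht hPt ->]]].
  exists (a * t - b * s), (s * t); split; last 1 first.
  + by field; rewrite !nz.
  + by apply: (sringB hB); exact: (sringM hB).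
  + exact: (sringM hB).
  + exact: hmul.
- move=> _ _ [a [s [ha hs hPs ->]]] [b [t [hb ht hPt ->]]].
  exists (a * b), (s * t); split; last 1 first.
  + by field; rewrite !nz.
  + exact: (sringM hB).
  + exact: (sringM hB).
  + exact: hmul.
Qed.

Lemma sub_localization : B `<=` localization B P.
Proof.
have [hPi hP1 hprime] := hP.
by move=> b hb; exists b, 1; rewrite divr1; split=> //; exact: (sring1 hB).
Qed.

Lemma localization_inv_notin a : P a -> a != 0 -> ~ localization B P a^-1.
Proof.
have [hPi hP1 hprime] := hP.
move=> ha a0 [b [s [hb hs hPs e]]]; apply: hPs.
have s0 : s != 0.
  by apply/eqP => s0; move: e a0; rewrite s0 invr0 mulr0 => /eqP; rewrite invr_eq0 => ->.
have -> : s = b * a.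
  by apply: (mulIf (_ : a^-1 != 0)); rewrite ?invr_eq0 // mulfK // e mulrCA divff ?mulr1.
exact: (idM hPi).
Qed.

Lemma local_max_sub_localization N : local_ring (localization B P) N ->
  forall z, N z -> exists a s, [/\ P a, B s, ~ P s & z = a / s].
Proof.
have [hPi hP1 hprime] := hP.
move=> locT z hz; have hN := local_ideal locT.
have [a [s [ha hs hPs e]]] := idS hN hz.
exists a, s; split=> //; apply: contrapT => hPa; apply: (local_n1 locT).
have nz t : ~ P t -> t != 0 by move=> h; apply/eqP => e'; apply: h; rewrite e'; exact: (id0 hPi).
have -> : 1 = (s / a) * z by rewrite e; field; rewrite !nz.
by apply: (idM hN) => //; exists s, a.
Qed.

Lemma sub_local_max N : noetherian (localization B P) ->
  local_ring (localization B P) N -> P `<=` N.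
Proof.
move=> noeT locT a ha; have [->|a0] := eqVneq a 0; first exact: (id0 (local_ideal locT)).
apply: contrapT => hNa; apply: (localization_inv_notin ha a0).
apply: (local_unit localization_subring noeT locT) => //.
by apply: sub_localization; have [hPi _ _] := hP; exact: (idS hPi).
Qed.

End Localization.

(** * Orders in a local quadratic transform *)

Section Transform.
Variables (F : fieldType) (S M : set F) (d : nat) (x : 'I_d -> F) (j : 'I_d).
Hypotheses (hS : subring S) (noeth : noetherian S) (locS : local_ring S M).
Hypotheses (genM : M = ideal_span S (range x)) (xM : forall i, M (x i)).
Hypothesis regular : forall a, ~ lead_set S M x [set 0] a.
Hypothesis nx0 : x j != 0.
Implicit Types (p q : {mpoly F[d]}).
Local Notation pow := (ideal_pow S M).
Local Notation x0 := (x j).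
Local Notation B := (blowup_chart S M x0).

Variable P : set F.
Hypotheses (hPp : prime_ideal B P) (hMP : M `<=` P).

Let hM : ideal S M := local_ideal locS.
Let hP : ideal B P. Proof. by case: hPp. Qed.
Let hB : subring B := blowup_chart_subring S M x0.

Definition chart_coord (i : 'I_d) : F := if i == j then 1 else x i / x0.
Let y := chart_coord.

Let yB i : B (y i).
Proof.
rewrite /y /chart_coord; case: ifP => _; first exact: (sring1 hB).
apply/(blowup_chartP hS hM (xM j) nx0); exists 1%N, (x i); rewrite expr1.
by split=> //; exact: ideal_pow1.
Qed.

(* The generic translation [y_i |-> y_i + Z_i] of the chart coordinates, applied to
   homogeneous representatives.  Modulo [P] it is well defined on the chart
   [S[m/x]], because the reduction of the chart modulo [m] is a polynomial ring in
   the [y_i] with [i != j]; it sends [P^k] into [(Z)^k] and does not raise the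
   degree, so a polynomial of degree at most [r] that is nonzero modulo [m] is not
   in [P^(r+1)]. *)
Definition translate_tuple : d.-tuple {mpoly F[d]} :=
  [tuple if i == j then 1 else (y i)%:MP + 'X_i | i < d].
Definition translate p := p \mPo translate_tuple.

Lemma coefs_in_translate I p : ideal B I -> coefs_in I p -> coefs_in I (translate p).
Proof.
move=> hI hp; rewrite /translate comp_mpolyE => g.
rewrite raddf_sum /=; apply: (id_sum hI) => m _.
rewrite mcoeffZ; apply: (idMr hI) => //.
have hBB := ideal_self hB.
suff : coefs_in B (\prod_(i < d) tnth translate_tuple i ^+ m i) by apply.
have h1 : coefs_in B (1 : {mpoly F[d]}).
  by move=> g'; rewrite mcoeff1; exact: (sring_nat hB).
apply: big_ind => // [u v hu hv|i _]; first exact: (coefs_inM hBB).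
elim: (m i) => [|k IH]; rewrite ?expr0 // exprS; apply: (coefs_inM hBB) => //.
rewrite tnth_mktuple; case: ifP => // _.
by apply: (coefs_inD hBB); [exact: (coefs_inC hBB)|exact: coefs_inX].
Qed.

Lemma coefs_in_translateS p : coefs_in S p -> coefs_in B (translate p).
Proof.
move=> hp; apply: coefs_in_translate; first exact: ideal_self.
by move=> g; exact: sub_blowup_chart.
Qed.

Lemma translate_M p : coefs_in M p -> coefs_in P (translate p).
Proof. by move=> hp; apply: coefs_in_translate => // g; exact: hMP. Qed.

Lemma mcoeff0_meval (u : {mpoly F[d]}) : u@_0 = u.@[fun=> 0].
Proof.
rewrite mevalE [in LHS](mpolyE u) raddf_sum /=; apply: eq_bigr => m _.
rewrite mcoeffZ mcoeffX; congr (_ * _); have [->|hm] := eqVneq m 0%MM.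
  by rewrite big1 // => i _; rewrite mnm0E expr0.
have [i hi] : exists i, m i != 0%N.
  apply: contrapT => hno; case/eqP: hm; apply/mnmP => i; rewrite mnm0E.
  by apply/eqP; apply: contrapT => h; apply: hno; exists i; apply/negP.
by rewrite (bigD1 i) //= expr0n (negPf hi) mul0r.
Qed.

Lemma eval_chart r p : p \is r.-homog -> p.@[x] / x0 ^+ r = p.@[y].
Proof.
move=> hp; rewrite !mevalE mulr_suml; apply: eq_big_seq => m hm.
rewrite -mulrA; congr (_ * _).
have <- : mdeg m = r by exact: (dhomog_mf hp).
rewrite mdegE -prodrXr -prodf_div; apply: eq_bigr => i _.
rewrite -expr_div_n /y /chart_coord; case: eqP => [->|//].
by rewrite divff.
Qed.

Lemma translate_coeff0 r p : p \is r.-homog -> (translate p)@_0 = p.@[x] / x0 ^+ r.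
Proof.
move=> hp; rewrite (eval_chart hp) mcoeff0_meval /translate comp_mpoly_meval.
apply: meval_eq => i; rewrite tnth_mktuple /y /chart_coord; case: (i == j).
  by rewrite meval1.
by rewrite mevalD mevalC mevalXU addr0.
Qed.

Definition deg_le k (u : {mpoly F[d]}) := forall g, (k < mdeg g)%N -> u@_g = 0.

Lemma deg_leM k l u v : deg_le k u -> deg_le l v -> deg_le (k + l) (u * v).
Proof.
move=> hu hv g hg; rewrite mcoeffM big1 // => -[k1 k2] /= /eqP e.
have [h1|h1] := ltnP k (mdeg k1); first by rewrite hu // mul0r.
rewrite [X in _ * X]hv ?mulr0 //.
have {}e : mdeg g = (mdeg k1 + mdeg k2)%N by rewrite -mdegD -e.
by lia.
Qed.

Lemma translate_deg r p : p \is r.-homog -> deg_le r (translate p).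
Proof.
move=> hp g hg; rewrite /translate comp_mpolyE raddf_sum /= big_seq big1 // => m hm.
rewrite mcoeffZ.
suff h : deg_le (mdeg m) (\prod_(i < d) tnth translate_tuple i ^+ m i).
  rewrite h ?mulr0 //; suff -> : mdeg m = r by [].
  exact: (dhomog_mf hp).
rewrite mdegE; apply: (big_ind2 deg_le) => [g'|a b c e ha hc|i _].
- by rewrite mcoeff1 -mdeg_eq0; case: (mdeg g').
- exact: deg_leM.
- elim: (m i) => [|k IH].
    by move=> g'; rewrite expr0 mcoeff1 -mdeg_eq0; case: (mdeg g').
  rewrite exprS -add1n; apply: deg_leM => // g' hg'.
  have g'0 : g' != 0%MM by rewrite -mdeg_eq0; case: (mdeg g') hg'.
  rewrite tnth_mktuple; case: ifP => _; first by rewrite mcoeff1 (negPf g'0).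
  rewrite mcoeffD mcoeffC (negPf g'0) mulr0 add0r mcoeffX.
  by case: eqP => // eg; move: hg'; rewrite -eg mdeg1.
Qed.

(** Substituting [X_i - y_i] for [X_i] undoes the translation and leaves [p] with [X_j] set to [1].
    A form of known degree is recovered from this, because [drop] is injective on exponents of a
    fixed degree. *)
Lemma translate_inj r p : p \is r.-homog -> coefs_in P (translate p) -> coefs_in P p.
Proof.
move=> hp hcp g.
pose back : d.-tuple {mpoly F[d]} := [tuple 'X_i - (y i)%:MP | i < d].
pose drop (m : 'X_{1..d}) : 'X_{1..d} := [multinom if i == j then 0%N else m i | i < d].
have hbk : translate p \mPo back = \sum_(m <- msupp p) p@_m *: 'X_[drop m].
  rewrite /translate (comp_mpolyE p) raddf_sum /=; apply: eq_bigr => m _.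
  rewrite comp_mpolyZ; congr (_ *: _); rewrite rmorph_prod /= mpolyXE_id.
  apply: eq_bigr => i _; rewrite rmorphXn /= tnth_mktuple mnmE; case: ifP => _.
    by rewrite comp_mpoly1 expr1n expr0.
  by rewrite comp_mpolyD comp_mpolyC comp_mpolyXU -tnth_nth tnth_mktuple addrC subrK.
have hbP : coefs_in P (translate p \mPo back).
  rewrite comp_mpolyE => g'; rewrite raddf_sum /=; apply: (id_sum hP) => m _.
  rewrite mcoeffZ; apply: (idMr hP) => //.
  have hBB := ideal_self hB.
  suff : coefs_in B (\prod_(i < d) tnth back i ^+ m i) by apply.
  have h1 : coefs_in B (1 : {mpoly F[d]}).
    by move=> g''; rewrite mcoeff1; exact: (sring_nat hB).
  apply: big_ind => // [u v hu hv|i _]; first exact: (coefs_inM hBB).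
  elim: (m i) => [|k IH]; rewrite ?expr0 // exprS; apply: (coefs_inM hBB) => //.
  rewrite tnth_mktuple; apply: (coefs_inB hB hBB); [exact: coefs_inX|exact: (coefs_inC hBB)].
have [hg|/memN_msupp_eq0 ->] := boolP (g \in msupp p); last exact: (id0 hP).
suff -> : p@_g = (translate p \mPo back)@_(drop g) by [].
rewrite hbk raddf_sum /= (bigD1_seq g) ?msupp_uniq //= mcoeffZ mcoeffX eqxx mulr1.
rewrite big_seq_cond big1 ?addr0 // => m /andP[hm hmg].
rewrite mcoeffZ mcoeffX; case: eqP => [e|_]; last by rewrite mulr0.
case/eqP: hmg; apply/mnmP => i.
have hi k : k != j -> m k = g k.
  by move=> hk; have /mnmP /(_ k) := e; rewrite !mnmE (negPf hk).
have [->|hij] := eqVneq i j; last exact: hi.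
have : mdeg m = mdeg g by rewrite (dhomog_mf hp hm) (dhomog_mf hp hg).
rewrite !mdegE (bigD1 j) //= [in RHS](bigD1 j) //=.
by rewrite [X in (_ + X)%N = _](eq_bigr g) => [/addIn //|k]; exact: hi.
Qed.

Lemma homogXj k : ('X_j ^+ k : {mpoly F[d]}) \is k.-homog.
Proof.
rewrite mpolyXn dhomogX; apply/eqP; rewrite -[RHS]mul1n -(mdeg1 j).
exact: mdegMn.
Qed.

Lemma coefs_inXj k : coefs_in S ('X_j ^+ k : {mpoly F[d]}).
Proof. by rewrite mpolyXn; exact: coefs_inX. Qed.

Lemma translateXj k : translate ('X_j ^+ k) = 1.
Proof.
by rewrite /translate rmorphXn /= comp_mpolyXU -tnth_nth tnth_mktuple eqxx expr1n.
Qed.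

Lemma evalXj k : ('X_j ^+ k : {mpoly F[d]}).@[x] = x0 ^+ k.
Proof. by rewrite rmorphXn /= mevalXU. Qed.

Lemma translateM p q : translate (p * q) = translate p * translate q.
Proof. exact: rmorphM. Qed.

Definition represents r p b := [/\ coefs_in S p, p \is r.-homog & b = p.@[x] / x0 ^+ r].

(** Cross-multiplying by powers of [X_j] gives a form that vanishes at [x]; by [quasi_regular] its
    coefficients are in [M], hence in [P] after translation, and the translation sends [X_j] to
    [1]. *)
Lemma translate_wd r p r' p' b : represents r p b -> represents r' p' b ->
  coefs_in P (translate p - translate p').
Proof.
move=> [hp1 hp2 hp3] [hq1 hq2 hq3].
have hSS := ideal_self hS.
pose u := p * 'X_j ^+ r' - p' * 'X_j ^+ r.
have hu : coefs_in S u.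
  apply: (coefs_inB hS hSS); apply: (coefs_inM hSS) => //; exact: coefs_inXj.
have huh : u \is (r + r').-homog.
  apply: rpredB; first by apply: dhomogM => //; exact: homogXj.
  by rewrite addnC; apply: dhomogM => //; exact: homogXj.
have e : u.@[x] = 0.
  rewrite /u mevalB !mevalM !evalXj; apply/eqP; rewrite subr_eq0; apply/eqP.
  have : p.@[x] / x0 ^+ r = p'.@[x] / x0 ^+ r' by rewrite -hp3.
  by move/eqP; rewrite eqr_div ?expf_neq0 // => /eqP.
have hx : pow (r + r').+1 u.@[x] by rewrite e; exact: (id0 (ideal_pow_ideal hS hM _)).
have := quasi_regular hS locS genM xM regular hu huh hx.
move/translate_M; rewrite /u /translate comp_mpolyB -/(translate _) -/(translate _).
by rewrite !translateM !translateXj !mulr1.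
Qed.

Lemma represents_exists b : B b -> exists r p, represents r p b.
Proof.
move/(blowup_chartP hS hM (xM j) nx0) => [r [a [ha ->]]].
by have [p [h1 h2 ->]] := pow_rep hS locS genM xM ha; exists r, p.
Qed.

Lemma represents_B r p b : represents r p b -> B b.
Proof.
move=> [h1 h2 ->]; apply/(blowup_chartP hS hM (xM j) nx0); exists r, p.@[x]; split=> //.
rewrite -(add0n r); apply: (eval_pow hS locS xM) => //; exact: homog_low.
Qed.

Lemma representsM r p b r' p' b' : represents r p b -> represents r' p' b' ->
  represents (r + r') (p * p') (b * b').
Proof.
move=> [hp1 hp2 ->] [hq1 hq2 ->]; split.
- exact: (coefs_inM (ideal_self hS)).
- exact: dhomogM.
- by rewrite mevalM exprD; field; rewrite !expf_neq0.
Qed.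

Lemma representsD r p b r' p' b' : represents r p b -> represents r' p' b' ->
  represents (r + r') (p * 'X_j ^+ r' + p' * 'X_j ^+ r) (b + b').
Proof.
move=> [hp1 hp2 ->] [hq1 hq2 ->]; have hSS := ideal_self hS; split.
- apply: (coefs_inD hSS); apply: (coefs_inM hSS) => //; exact: coefs_inXj.
- apply: rpredD; first by apply: dhomogM => //; exact: homogXj.
  by rewrite addnC; apply: dhomogM => //; exact: homogXj.
- by rewrite mevalD !mevalM !evalXj exprD; field; rewrite !expf_neq0.
Qed.

Definition low_in k (u : {mpoly F[d]}) := forall g, (mdeg g < k)%N -> P u@_g.

Lemma low_inM k l u v : coefs_in B u -> coefs_in B v -> low_in k u -> low_in l v ->
  low_in (k + l) (u * v).
Proof.
move=> hu hv hku hlv g hg; rewrite mcoeffM; apply: (id_sum hP) => -[k1 k2] /= /eqP e.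
have [h1|h1] := ltnP (mdeg k1) k; first by apply: (idMr hP) => //; exact: hku.
apply: (idM hP) => //; apply: hlv.
have {}e : mdeg g = (mdeg k1 + mdeg k2)%N by rewrite -mdegD -e.
by lia.
Qed.

(** The elements whose translation lies in [(Z)^k] modulo [P]. This filtration is multiplicative and
    contains [P] in level [1], so it bounds the powers of the maximal ideal of the transform from
    above while being readable on coefficients. *)
Definition chart_filtration k b := exists r p, represents r p b /\ low_in k (translate p).

Lemma chart_filtrationM k l b b' : chart_filtration k b -> chart_filtration l b' ->
  chart_filtration (k + l) (b * b').
Proof.
move=> [r [p [hp hk]]] [r' [p' [hp' hl]]]; exists (r + r')%N, (p * p'); split.
  exact: representsM.
by rewrite translateM; apply: low_inM => //; apply: coefs_in_translateS; [case: hp|case: hp'].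
Qed.

Lemma chart_filtrationD k b b' : chart_filtration k b -> chart_filtration k b' ->
  chart_filtration k (b + b').
Proof.
move=> [r [p [hp hk]]] [r' [p' [hp' hl]]].
exists (r + r')%N, (p * 'X_j ^+ r' + p' * 'X_j ^+ r); split; first exact: representsD.
move=> g hg; rewrite /translate comp_mpolyD -/(translate _) -/(translate _) !translateM.
by rewrite !translateXj !mulr1 mcoeffD; apply: (idD hP); [exact: hk|exact: hl].
Qed.

Lemma chart_filtration0 b : B b -> chart_filtration 0 b.
Proof. by move=> /represents_exists [r [p hp]]; exists r, p. Qed.

Lemma chart_filtration1 b : P b -> chart_filtration 1 b.
Proof.
move=> hb; have [r [p hp]] := represents_exists (idS hP hb).
exists r, p; split=> // g; rewrite ltnS leqn0 mdeg_eq0 => /eqP ->.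
by case: hp => _ hh e; rewrite (translate_coeff0 hh) -e.
Qed.

Lemma chart_filtration_B k b : chart_filtration k b -> B b.
Proof. by move=> [r [p [/represents_B]]]. Qed.

Local Notation T := (localization B P).

Definition transform_filtration k : set F :=
  [set z | exists s, [/\ B s, ~ P s & chart_filtration k (s * z)]].

Let nzP s : ~ P s -> s != 0.
Proof. by move=> h; apply/eqP => e; apply: h; rewrite e; exact: (id0 hP). Qed.

Let mulnP s t : B s -> B t -> ~ P s -> ~ P t -> ~ P (s * t).
Proof. by case: hPp => _ _ h h1 h2 h3 h4 /h []. Qed.

Lemma transform_filtration_ideal k : ideal T (transform_filtration k).
Proof.
have hBS b : B b -> chart_filtration 0 b by exact: chart_filtration0.
split.
- move=> z [s [hs hsP hk]]; exists (s * z), s; split=> //.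
    exact: chart_filtration_B hk.
  by rewrite mulrAC divff ?mul1r // nzP.
- exists 1; split; [exact: (sring1 hB)|by case: hPp|rewrite mulr0].
  exists 0%N, 0; split.
    split; [|exact: rpred0|by rewrite meval0 mul0r].
    by move=> g; rewrite mcoeff0; exact: (sring0 hS).
  by move=> g _; rewrite /translate comp_mpoly0 mcoeff0; exact: (id0 hP).
- move=> z z' [s [hs hsP hk]] [s' [hs' hsP' hk']]; exists (s * s'); split.
  + exact: (sringM hB).
  + exact: mulnP.
  + have -> : s * s' * (z + z') = s' * (s * z) + s * (s' * z') by ring.
    by apply: chart_filtrationD; rewrite -(add0n k); apply: chart_filtrationM; auto.
- move=> _ z [b [c [hb hc hcP ->]]] [s [hs hsP hk]]; exists (c * s); split.
  + exact: (sringM hB).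
  + exact: mulnP.
  + have -> : c * s * (b / c * z) = b * (s * z) by field; rewrite nzP.
    by rewrite -(add0n k); apply: chart_filtrationM; auto.
Qed.

Lemma pow_sub_filtration N k : local_ring T N ->
  ideal_pow T N k `<=` transform_filtration k.
Proof.
move=> locT; elim: k => [|k IH].
  move=> z [b [s [hb hs hsP ->]]]; exists s; split=> //.
  by rewrite mulrCA divff ?nzP // mulr1; exact: chart_filtration0.
apply: ideal_mul_sub; first exact: transform_filtration_ideal.
move=> u v /(local_max_sub_localization hPp locT) [a [s [ha hs hsP ->]]].
move=> /IH [s' [hs' hsP' hk]]; exists (s * s'); split.
- exact: (sringM hB).
- exact: mulnP.
- have -> : s * s' * (a / s * v) = a * (s' * v) by field; rewrite nzP.
  by rewrite -add1n; apply: chart_filtrationM => //; exact: chart_filtration1.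
Qed.

(** If the claim fails, some [s] outside [P] makes the product of the translations of [u] (for [s])
    and [p] (for [a]) vanish modulo [P] in degrees at most [r]. The constant term of the first is
    [s], and the second has degree at most [r], so Gauss's lemma forces the second to vanish modulo
    [P]. Then [p] has coefficients in [M], and [a] has order above [r]. *)
Theorem transform_order N r a : local_ring T N -> pow r a -> ~ pow r.+1 a ->
  ~ ideal_pow T N r.+1 (a / x0 ^+ r).
Proof.
move=> locT ha ha' /(pow_sub_filtration locT) [s [hs hsP [t [q [hq hlow]]]]].
have [p [hp hph ep]] := pow_rep hS locS genM xM ha.
have [k [u hu]] := represents_exists hs.
have hrp : represents r p (a / x0 ^+ r) by split=> //; rewrite ep.
have hup := representsM hu hrp.
have hBB := ideal_self hB.
have hlow' : low_in r.+1 (translate u * translate p).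
  move=> g hg; rewrite -translateM.
  rewrite -[translate (u * p)](subrK (translate q)) mcoeffD; apply: (idD hP).
    exact: (translate_wd hup hq).
  exact: hlow.
have [hu1 hu2 hu3] := hu.
have hup0 : ~ P (translate u)@_0 by rewrite (translate_coeff0 hu2) -hu3.
have hall : coefs_in P (translate p).
  apply: contrapT => /min_notin [al ha1 ha2].
  apply: (gauss hB hPp _ _ hup0 _ ha1 ha2).
  - exact: coefs_in_translateS.
  - exact: coefs_in_translateS.
  - by move=> g; rewrite ltNge le0m.
  - rewrite add0m; apply: hlow'; rewrite ltnNge; apply/negP => hal.
    by apply: ha1; rewrite (translate_deg hph) //; exact: (id0 hP).
apply: ha'; rewrite ep -add1n; apply: (eval_pow hS locS xM); last exact: homog_low.
rewrite (ideal_pow1E hS hM) => g; apply: contrapT => hMg.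
have hPg := translate_inj hph hall g.
(* A coefficient of [p] outside [M] is a unit of [S], so its membership in [P] would put [1] in
   [P]. *)
case: hPp => _ + _; apply.
have g0 : p@_g != 0 by apply/eqP => e; apply: hMg; rewrite e; exact: (id0 hM).
rewrite -(mulVf g0); apply: (idM hP) => //.
by apply: sub_blowup_chart; exact: (local_unit hS noeth locS).
Qed.

End Transform.

(** * Valuation rings *)

Section ValuationRings.
Variables (F : fieldType) (W : set F).
Hypothesis hW : valuation_ring W.

(** Zero is listed apart because [0^-1] is [0], which lies in [W]. *)
Definition valuation_max : set F := [set z | z = 0 \/ ~ W z^-1].
Local Notation vmax := valuation_max.

Let hWs : subring W. Proof. by case: hW. Qed.

Lemma valuation_total t : W t \/ W t^-1.
Proof.
have [->|] := eqVneq t 0; first by left; exact: sring0.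
by case: hW => _; apply.
Qed.

Lemma vmax_sub : vmax `<=` W.
Proof. by move=> z [->|h]; [exact: sring0|have [] := valuation_total z]. Qed.

Lemma vmaxPn z : ~ vmax z -> z != 0 /\ W z^-1.
Proof.
move=> h; split; first by apply/eqP => e; apply: h; left.
by apply: contrapT => h'; apply: h; right.
Qed.

Lemma vmax_ideal : ideal W vmax.
Proof.
have hmul a z : W a -> vmax z -> vmax (a * z).
  move=> ha [->|hz]; first by left; rewrite mulr0.
  have [->|a0] := eqVneq a 0; first by left; rewrite mul0r.
  right => h; apply: hz; have -> : z^-1 = a * (a * z)^-1 by rewrite invfM mulVKf.
  exact: (sringM hWs).
have hadd w z : W (z / w) -> w != 0 -> vmax w -> vmax (z + w).
  move=> h w0 hw; have -> : z + w = (z / w + 1) * w by rewrite mulrDl divfK // mul1r.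
  by apply: hmul => //; apply: (sringD hWs) => //; exact: (sring1 hWs).
split=> //; [exact: vmax_sub|by left|].
move=> z w hz hw.
have [->|z0] := eqVneq z 0; first by rewrite add0r.
have [->|w0] := eqVneq w 0; first by rewrite addr0.
have [h|h] := valuation_total (z / w); first exact: hadd.
by rewrite addrC; apply: hadd => //; rewrite -invf_div.
Qed.

Lemma vmax_n1 : ~ vmax 1.
Proof. by case=> [/eqP|]; rewrite ?oner_eq0 // invr1; apply; exact: (sring1 hWs). Qed.

Lemma vmax_prime z w : W z -> W w -> vmax (z * w) -> vmax z \/ vmax w.
Proof.
move=> hz hw hzw; apply: contrapT => /not_orP [/vmaxPn [z0 hz'] /vmaxPn [w0 hw']].
apply: vmax_n1; have -> : 1 = (z^-1 * w^-1) * (z * w) by field; rewrite z0 w0.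
by apply: (idM vmax_ideal) => //; exact: (sringM hWs).
Qed.

Definition geom m (t : F) := \sum_(0 <= j < m.+1) t ^+ j.

Lemma geomS m t : geom m.+1 t = geom m t * t + 1.
Proof.
rewrite /geom big_nat_recl // expr0 addrC; congr (_ + _).
by rewrite mulr_suml; apply: eq_bigr => j _; rewrite exprSr.
Qed.

Lemma geom_subX m t : (t - 1) * geom m t = t ^+ m.+1 - 1.
Proof.
elim: m => [|m IH]; first by rewrite /geom big_nat1 expr0 expr1 mulr1.
by rewrite geomS mulrDr mulrA IH !exprSr; ring.
Qed.

Lemma geom_inv m t : t != 0 -> geom m t = t ^+ m * geom m t^-1.
Proof.
move=> t0; rewrite /geom mulr_sumr big_nat_rev /= add0n.
apply: eq_big_nat => j /andP[_ hj]; rewrite subSS exprVn.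
by rewrite -{2}(subnK (_ : j <= m)%N) // exprD mulfK // expf_neq0.
Qed.

Lemma geom_W m t : W t -> W (geom m t).
Proof. by move=> ht; apply: (sring_sum hWs) => j _; exact: (sringX hWs). Qed.

Lemma geom_congr m t : vmax (t - 1) -> vmax (geom m t - m.+1%:R).
Proof.
move=> ht; have ht' : W t.
  by rewrite -(subrK 1 t); apply: (sringD hWs); [exact: vmax_sub|exact: (sring1 hWs)].
elim: m => [|m IH]; first by rewrite /geom big_nat1 expr0 subrr; left.
have -> : geom m.+1 t - m.+2%:R = t * (geom m t - m.+1%:R) + m.+1%:R * (t - 1).
  by rewrite geomS -(addn1 m.+1) natrD; ring.
apply: (idD vmax_ideal); apply: (idM vmax_ideal) => //; exact: (sring_nat hWs).
Qed.

(* [m0] is the multiplicative order of the residue of [t] if this is finite and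
   greater than [1], and the residue characteristic if [t] has residue [1]: then
   [(t - 1)(1 + ... + t^m) = t^(m+1) - 1] and [1 + ... + t^m] have the residues of
   [t - 1] and of [1] respectively. *)
Lemma geom_unit t : W t -> exists2 m0, (0 < m0)%N &
  forall m, (m0 %| m)%N -> ~ vmax (geom m t).
Proof.
move=> ht; have [h1|h1] := pselect (vmax (t - 1)).
  have hcase m : ~ vmax m.+1%:R -> ~ vmax (geom m t).
    move=> h hm; apply: h.
    have -> : m.+1%:R = geom m t - (geom m t - m.+1%:R) by rewrite opprB addrC subrK.
    by apply: (idB hWs vmax_ideal) => //; exact: geom_congr.
  have [[k k0 hk]|hk] := pselect (exists2 k, (0 < k)%N & vmax k%:R).
    exists k => // m /dvdnP [q ->]; apply: hcase => h; apply: vmax_n1.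
    have -> : 1 = (q * k).+1%:R - q%:R * k%:R :> F.
      by rewrite -natrM -addn1 natrD addrAC subrr add0r.
    apply: (idB hWs vmax_ideal) => //; apply: (idM vmax_ideal) => //; exact: (sring_nat hWs).
  by exists 1%N => // m _; apply: hcase => h; apply: hk; exists m.+1.
have hcase m : ~ vmax (t ^+ m.+1 - 1) -> ~ vmax (geom m t).
  move=> h hm; apply: h; rewrite -geom_subX; apply: (idM vmax_ideal) => //.
  by apply: (sringB hWs) => //; exact: (sring1 hWs).
have [[k k0 hk]|hk] := pselect (exists2 k, (0 < k)%N & vmax (t ^+ k - 1)).
  exists k => // m /dvdnP [q ->]; apply: hcase => h; apply: h1.
  have htq : vmax (t ^+ (q * k) - 1).
    rewrite mulnC exprM subrX1; apply: (idMr vmax_ideal) => //.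
    by apply: (sring_sum hWs) => i _; apply: (sringX hWs); exact: (sringX hWs).
  have -> : t - 1 = (t ^+ (q * k).+1 - 1) - t * (t ^+ (q * k) - 1) by rewrite exprS; ring.
  by apply: (idB hWs vmax_ideal) => //; exact: (idM vmax_ideal).
by exists 1%N => // m _; apply: hcase => h; apply: hk; exists m.+1.
Qed.

(** In terms of the valuation [v] of [W]: [geom m t] has value exactly [m min(0, v(t))]. The two
    memberships give the upper bounds [0] and [m v(t)]; the lower bound is automatic. *)
Definition geom_good m t := [/\ geom m t != 0, W (geom m t)^-1 & W (t ^+ m / geom m t)].

Lemma geom_good_vmax m t : vmax t -> ~ vmax (geom m t).
Proof.
move=> ht hm; apply: vmax_n1; case: m hm => [|m]; first by rewrite /geom big_nat1 expr0.
rewrite geomS => hm; apply: (id_addl hWs vmax_ideal _ hm).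
by apply: (idM vmax_ideal) => //; apply: geom_W; exact: vmax_sub.
Qed.

Lemma geom_good_unit m t : W t -> ~ vmax (geom m t) -> geom_good m t.
Proof.
move=> ht /vmaxPn [h1 h2]; split=> //.
by apply: (sringM hWs) => //; exact: (sringX hWs).
Qed.

(** Factoring out [t^m] leaves the same sum in [1/t], which has residue [1]; no condition on [m]
    arises. *)
Lemma geom_good_notW m t : ~ W t -> geom_good m t.
Proof.
move=> ht; have t0 : t != 0 by apply/eqP => e; apply: ht; rewrite e; exact: (sring0 hWs).
have htv : vmax t^-1 by right; rewrite invrK.
have [h1 h2] := vmaxPn (geom_good_vmax (m := m) htv).
have hti := vmax_sub htv.
have tm0 : t ^+ m != 0 by rewrite expf_neq0.
split; rewrite geom_inv //.
- by rewrite mulf_neq0.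
- by rewrite invfM -exprVn; apply: (sringM hWs) => //; exact: (sringX hWs).
- by rewrite invfM mulVKf.
Qed.

Lemma geom_good_exists t : exists2 m0, (0 < m0)%N &
  forall m, (m0 %| m)%N -> geom_good m t.
Proof.
have [ht|ht] := pselect (W t); last by exists 1%N => // m _; exact: geom_good_notW.
by have [m0 h0 hm] := geom_unit ht; exists m0 => // m /hm; exact: geom_good_unit.
Qed.

Lemma geom_good_pow m t j : geom_good m t -> (j <= m)%N -> W (t ^+ j / geom m t).
Proof.
move=> [h0 h1 h2] hj; have [ht|ht] := pselect (W t).
  by apply: (sringM hWs) => //; exact: (sringX hWs).
have t0 : t != 0 by apply/eqP => e; apply: ht; rewrite e; exact: (sring0 hWs).
have {}ht : W t^-1 by have [] := valuation_total t.
have -> : t ^+ j / geom m t = t^-1 ^+ (m - j) * (t ^+ m / geom m t).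
  have -> : t ^+ m = t ^+ (m - j) * t ^+ j by rewrite -exprD subnK.
  by rewrite exprVn; field; rewrite h0 expf_neq0.
by apply: (sringM hWs) => //; exact: (sringX hWs).
Qed.

End ValuationRings.

(** * Neighborhoods and separation in the patch topology *)

Section PatchTopology.
Variable F : fieldType.

Lemma zar_nbhsP (W : zar F) (N : set (zar F)) :
  nbhs W N <-> exists XY, [/\ patch_index XY, patch_base XY W & patch_base XY `<=` N].
Proof.
rewrite nbhsE; split=> [[O [hO OW] ON]|[XY [h1 h2 h3]]].
  have [D' hD' e] : exists2 D', D' `<=` @patch_index F & \bigcup_(i in D') @patch_base F i = O.
    exact: hO.
  move: OW; rewrite -e => -[XY hXY hW]; exists XY; split=> //; first exact: hD'.
  by move=> z hz; apply: ON; rewrite -e; exists XY.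
exists (patch_base XY) => //; split=> //.
exists [set XY] => [_ -> //|]; exact: bigcup_set1.
Qed.

Lemma zar_eq (W W' : zar F) : (forall t, val W t <-> val W' t) -> W = W'.
Proof. by move=> h; apply: val_inj; apply/seteqP; split=> t /h. Qed.

(** The shape of the neighborhood is recorded because membership of one fixed [t] is eventually
    constant along a convergent sequence. *)
Lemma zar_sep (W W' : zar F) : W <> W' ->
  exists N : set (zar F), [/\ nbhs W N, ~ N W' &
   (exists t, N = [set Z | val Z t]) \/ (exists t, N = [set Z | ~ val Z t])].
Proof.
move=> hne; apply: contrapT => hno; apply: hne; apply: zar_eq => t; split=> h.
- apply: contrapT => h'; apply: hno; exists [set Z | val Z t]; split=> //; last by left; exists t.
  apply/zar_nbhsP; exists ([set t], set0); split.
  + by split; [exact: finite_set1|exact: finite_set0].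
  + by split=> [_ ->|].
  + by move=> Z [hZ _]; exact: hZ.
- apply: contrapT => h'; apply: hno; exists [set Z | ~ val Z t]; split=> //; last by right; exists t.
    apply/zar_nbhsP; exists (set0, [set t]); split.
    + by split; [exact: finite_set0|exact: finite_set1].
    + by split=> [|_ ->].
    + by move=> Z [_ hZ]; exact: hZ.
Qed.

End PatchTopology.

(** * Intersections of convergent sequences of valuation rings *)

Section SequenceOfValuations.
Variables (F : fieldType) (V : nat -> set F).
Hypothesis hV : forall n, valuation_ring (V n).
(** [archV] and [uniformizerV] together express that each [V n] is a discrete valuation ring of rank
    one, without a value group. *)
Hypothesis archV : forall n p q, valuation_max (V n) p -> V n q -> q != 0 ->
  exists k, V n (p ^+ k / q).
Hypothesis uniformizerV : forall n, exists2 p, p != 0 &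
  valuation_max (V n) p /\ forall z, valuation_max (V n) z -> V n (z / p).
Hypothesis geomV : forall t, t != 0 -> exists2 m, (0 < m)%N & forall n, geom_good (V n) m t.
Hypothesis eventuallyV : forall t, t != 0 -> exists N,
  (forall n, (N <= n)%N -> V n t) \/ (forall n, (N <= n)%N -> ~ V n t).
Hypothesis properV : exists2 x, x != 0 & forall n, ~ V n x^-1.
Hypothesis distinctV : forall n, V n.+1 <> V n.

Let hVs n : subring (V n). Proof. by case: (hV n). Qed.
Let vmax n := valuation_max (V n).
Let vmaxI n : ideal (V n) (vmax n). Proof. exact: vmax_ideal. Qed.

Definition limit_ring : set F := [set t | exists N, forall n, (N <= n)%N -> V n t].
Local Notation U := limit_ring.

Lemma limit_ringPn t : ~ U t -> exists N, forall n, (N <= n)%N -> ~ V n t.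
Proof.
move=> hU; have t0 : t != 0.
  by apply/eqP => e; apply: hU; exists 0%N => n _; rewrite e; exact: (sring0 (hVs n)).
have [N [h|//]] := eventuallyV t0; last by exists N.
by case: hU; exists N.
Qed.

Lemma limit_ring_valuation : valuation_ring U.
Proof.
have hmax (P Q : nat -> Prop) N N' : (forall n, (N <= n)%N -> P n) ->
    (forall n, (N' <= n)%N -> Q n) -> forall n, (maxn N N' <= n)%N -> P n /\ Q n.
  by move=> hP hQ n; rewrite geq_max => /andP[h1 h2]; split; [exact: hP|exact: hQ].
split.
  apply/subringP; split.
  - by exists 0%N => n _; exact: (sring1 (hVs n)).
  - move=> a b [N hN] [N' hN']; exists (maxn N N') => n /(hmax _ _ _ _ hN hN') [h1 h2].
    exact: (sringB (hVs n)).
  - move=> a b [N hN] [N' hN']; exists (maxn N N') => n /(hmax _ _ _ _ hN hN') [h1 h2].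
    exact: (sringM (hVs n)).
move=> t t0; have [h|/limit_ringPn [N hN]] := pselect (U t); [by left|right].
by exists N => n /hN h; have [] := valuation_total (hV n) t.
Qed.

Let hU := limit_ring_valuation.
Let hUs : subring U. Proof. by case: hU. Qed.

Definition holomorphy : set F := \bigcap_(i in [set k | (1 <= k)%N]) V i.
Local Notation A := holomorphy.

Lemma holomorphy_subring : subring A.
Proof.
apply/subringP; split.
- by move=> n _; exact: (sring1 (hVs n)).
- by move=> a b ha hb n hn; apply: (sringB (hVs n)); [exact: ha|exact: hb].
- by move=> a b ha hb n hn; apply: (sringM (hVs n)); [exact: ha|exact: hb].
Qed.
Let hA := holomorphy_subring.

Lemma holomorphy_sub_limit : A `<=` U.
Proof. by move=> z hz; exists 1%N => n hn; exact: hz. Qed.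

Lemma geom_holomorphy t : t != 0 -> exists2 m, (0 < m)%N &
  geom m t != 0 /\ (forall n, geom_good (V n) m t) /\
  forall j, (j <= m)%N -> A (t ^+ j / geom m t).
Proof.
move=> t0; have [m m0 hm] := geomV t0; exists m => //; split; first by case: (hm 0%N).
by split=> // j hj n _; exact: (geom_good_pow (hV n)).
Qed.

Lemma holomorphy_localization M : prime_ideal A M -> valuation_domain (localization A M).
Proof.
move=> hMp; split; first exact: localization_subring.
have [hM hM1 _] := hMp.
move=> t _ t0; have [m m0 [u0 [_ hj]]] := geom_holomorphy t0.
have [j hjm hjM] : exists2 j, (j <= m)%N & ~ M (t ^+ j / geom m t).
  apply: contrapT => hno; apply: hM1.
  have -> : 1 = \sum_(0 <= j < m.+1) t ^+ j / geom m t by rewrite -mulr_suml divff.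
  rewrite big_nat; apply: (id_sum hM) => j /andP[_ hjm].
  by apply: contrapT => h; apply: hno; exists j.
(* Neighboring terms have quotient [t]: the next term over the [j]-th gives [t], and for [j = m] the
   previous one gives [1/t], which exists because [m] is positive. *)
have [hlt|hge] := ltnP j m.
  left; exists (t ^+ j.+1 / geom m t), (t ^+ j / geom m t).
  split; [exact: hj _ hlt|exact: hj _ hjm|exact: hjM|].
  by rewrite exprS; field; rewrite u0 expf_neq0.
have ejm : j = m by apply/eqP; rewrite eqn_leq hjm.
right; exists (t ^+ m.-1 / geom m t), (t ^+ m / geom m t).
split; [exact: hj _ (leq_pred m)|exact: hj _ (leqnn m)|by rewrite -{1}ejm|].
by rewrite -{3}(prednK m0) exprS; field; rewrite t0 u0 expf_neq0.
Qed.

Lemma maximal_prime I : maximal_ideal A I -> prime_ideal A I.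
Proof.
move=> [hI hne hmax]; split=> //.
  by move=> h1; apply: hne; exact: ideal_eqT.
move=> a b ha hb hab; have [h|h] := pselect (I a); [by left|right].
have hJ : ideal A (idealD I (principal A a)).
  by apply: idealD_ideal => //; exact: principal_ideal.
have [] := hmax _ hJ (@idealDl _ _ _ _ (principal_ideal hA ha)).
  by move=> e; case: h; rewrite -e; apply: (idealDr hI); exact: principal_self.
move=> e; have [i [_ [hi [c hc ->] e1]]] : idealD I (principal A a) 1.
  by rewrite e; exact: (sring1 hA).
rewrite -(mul1r b) e1 mulrDl; apply: (idD hI); first exact: (idMr hI).
by rewrite -mulrA; apply: (idM hI).
Qed.

Lemma holomorphy_prufer : prufer_domain A.
Proof.
by split=> // M /maximal_prime; exact: holomorphy_localization.
Qed.

Definition center (W : set F) : set F := A `&` valuation_max W.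

Lemma center_prime W : valuation_ring W -> A `<=` W -> prime_ideal A (center W).
Proof.
move=> hW hAW; have hI := vmax_ideal hW.
split.
- split.
  + by move=> z [].
  + by split; [exact: (sring0 hA)|exact: (id0 hI)].
  + by move=> a b [ha ha'] [hb hb']; split; [exact: (sringD hA)|exact: (idD hI)].
  + move=> a b ha [hb hb']; split; first exact: (sringM hA).
    by apply: (idM hI) => //; exact: hAW.
- by case=> _; exact: vmax_n1 hW.
- move=> a b ha hb [_ hab].
  by have [|] := vmax_prime hW (hAW _ ha) (hAW _ hb) hab; [left|right].
Qed.

Lemma center_inv W a : A a -> ~ center W a -> a != 0 /\ W a^-1.
Proof. by move=> ha h; apply: vmaxPn => h'; apply: h. Qed.

(** For [t] in [W] write [t = (t/u) / (1/u)] with [u = geom m t]. Both parts are in [A], and [1/u]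
    is outside the center because [u] is in [W]. *)
Lemma center_localization W : valuation_ring W -> A `<=` W ->
  (forall m t, W t -> (forall n, geom_good (V n) m t) -> W (geom m t)) ->
  localization A (center W) = W.
Proof.
move=> hW hAW hgeom; have [hWs _] := hW; apply/seteqP; split.
  move=> _ [a [s [ha hs hsM ->]]]; have [_ h] := center_inv hs hsM.
  by apply: (sringM hWs) => //; exact: hAW.
move=> t ht; have [->|t0] := eqVneq t 0.
  exists 0, 1; rewrite mul0r; split=> //; [exact: (sring0 hA)|exact: (sring1 hA)|].
  by case=> _; exact: vmax_n1 hW.
have [m m0 [u0 [hgood hj]]] := geom_holomorphy t0.
exists (t ^+ 1 / geom m t), (t ^+ 0 / geom m t); split.
- exact: hj _ m0.
- exact: hj _ (leq0n m).
- rewrite expr0 mul1r => -[_ []]; first by move/eqP; rewrite invr_eq0 (negPf u0).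
  by rewrite invrK; apply; exact: hgeom ht hgood.
- by rewrite expr0 expr1 mul1r invrK divfK.
Qed.

Let M_ i := center (V i).
Let M := center U.

Let hAV i : (1 <= i)%N -> A `<=` V i. Proof. by move=> hi z; apply. Qed.
Let M_prime i : (1 <= i)%N -> prime_ideal A (M_ i).
Proof. by move=> hi; apply: center_prime => //; exact: hAV. Qed.
Let M_ideal i : (1 <= i)%N -> ideal A (M_ i).
Proof. by move=> hi; case: (M_prime hi). Qed.
Let MU_prime : prime_ideal A M.
Proof. by apply: center_prime => //; exact: holomorphy_sub_limit. Qed.
Let MU_ideal : ideal A M. Proof. by case: MU_prime. Qed.

Lemma localization_center i : (1 <= i)%N -> localization A (M_ i) = V i.
Proof.
move=> hi; apply: center_localization => //; first exact: hAV.
by move=> m t ht _; exact: geom_W.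
Qed.

Lemma localization_limit_center : localization A M = U.
Proof.
apply: center_localization => //; first exact: holomorphy_sub_limit.
by move=> m t ht _; exact: geom_W.
Qed.

Lemma limit_ring_proper : exists2 x, x != 0 & ~ U x^-1.
Proof.
have [x x0 hx] := properV; exists x => // -[N hN].
by apply: (hx N); exact: hN.
Qed.

(** A valuation ring of rank one is a maximal proper subring of [F]: with some [t] outside [V i],
    the archimedean property would put all inverses of nonzero elements of [V i] into [U], against
    [properV]. *)
Lemma limit_ring_eqV i : V i `<=` U -> V i = U.
Proof.
move=> hVU; apply/seteqP; split=> // t ht; apply: contrapT => hVt.
have t0 : t != 0 by apply/eqP => e; apply: hVt; rewrite e; exact: (sring0 (hVs i)).
have hti : vmax i t^-1 by right; rewrite invrK.
have [x x0 hxU] := limit_ring_proper.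
have hq q : V i q -> q != 0 -> U q^-1.
  move=> hq q0; have [k hk] := archV hti hq q0.
  have -> : q^-1 = t ^+ k * (t^-1 ^+ k / q) by rewrite exprVn mulrA divff ?mul1r // expf_neq0.
  by apply: (sringM hUs); [exact: (sringX hUs)|exact: hVU].
have [hx|hx] := valuation_total (hV i) x; apply: hxU; first exact: hq.
exact: hVU.
Qed.

Lemma limit_center_sub i : (1 <= i)%N -> M `<=` M_ i -> V i = U.
Proof.
move=> hi hM; apply: limit_ring_eqV; rewrite -(localization_center hi) -localization_limit_center.
by move=> _ [a [s [ha hs hsM ->]]]; exists a, s; split=> // /hM.
Qed.

(* Replacing [c] by [c^m (1 + b/c + ... + (b/c)^m)], whose value in every [V n] is
   [m min (v(b), v(c))], removes the zeros of [c] one valuation at a time. *)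
Lemma ideal_avoid J a : ideal A J -> J a -> ~ M a ->
  (forall i, (1 <= i)%N -> ~ (J `<=` M_ i)) -> J 1.
Proof.
move=> hJ hJa hMa hJM.
have [a0 hUa] := center_inv (idS hJ hJa) hMa.
have [N0 hN0] := hUa.
suff h k : exists2 c, J c /\ c != 0 &
    forall n, (N0 <= n)%N || (1 <= n <= k)%N -> V n c^-1.
  have [c [hc c0] hcV] := h N0.
  rewrite -(mulVf c0); apply: (idM hJ) => // n hn; apply: hcV.
  by case: (leqP N0 n) => //= hlt; apply/andP; split; [exact: hn|exact: ltnW].
elim: k => [|k [c [hc c0] hcV]].
  by exists a => // n; rewrite orbC; case: n => //= n; exact: hN0.
have [b hJb hMb] : exists2 b, J b & ~ M_ k.+1 b.
  apply: contrapT => hno; apply: (hJM k.+1) => // b hb.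
  by apply: contrapT => h; apply: hno; exists b.
have [b0 hVb] := center_inv (idS hJ hJb) hMb.
have t0 : b / c != 0 by rewrite mulf_neq0 // invr_eq0.
have [m m0 [u0 [hgood _]]] := geom_holomorphy t0.
have hbA := idS hJ hJb; have hcA := idS hJ hc.
exists (c ^+ m * geom m (b / c)).
  split; last by rewrite mulf_neq0 // expf_neq0.
  rewrite /geom mulr_sumr big_nat; apply: (id_sum hJ) => j /andP[_ hj].
  have -> : c ^+ m * (b / c) ^+ j = b ^+ j * c ^+ (m - j).
    have -> : c ^+ m = c ^+ (m - j) * c ^+ j by rewrite -exprD subnK.
    by rewrite expr_div_n; field; rewrite expf_neq0.
  case: j hj => [|j] hj.
    rewrite expr0 mul1r subn0 -(prednK m0) exprS; apply: (idMr hJ) => //.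
    exact: (sringX hA).
  rewrite exprS -mulrA; apply: (idMr hJ) => //.
  by apply: (sringM hA); exact: (sringX hA).
move=> n hn; have [_ h1 h2] := hgood n.
have [hn'|hn'] := boolP ((N0 <= n)%N || (1 <= n <= k)%N).
  rewrite invfM -exprVn; apply: (sringM (hVs n)) => //.
  by apply: (sringX (hVs n)); exact: hcV.
have {hn hn'} -> : n = k.+1 by move: hn hn'; rewrite !(leq_eqVlt n); lia.
have [_ h1' h2'] := hgood k.+1.
have -> : (c ^+ m * geom m (b / c))^-1 = b^-1 ^+ m * ((b / c) ^+ m / geom m (b / c)).
  by rewrite expr_div_n exprVn; field; rewrite u0 !expf_neq0.
by apply: (sringM (hVs _)) => //; exact: (sringX (hVs _)).
Qed.

Lemma proper_sub_center J : ideal A J -> ~ J 1 -> J `<=` M \/ exists2 i, (1 <= i)%N & J `<=` M_ i.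
Proof.
move=> hJ hJ1; apply: contrapT => /not_orP [h1 h2]; apply: hJ1.
have [a hJa hMa] : exists2 a, J a & ~ M a.
  by apply: contrapT => hno; apply: h1 => a ha; apply: contrapT => h; apply: hno; exists a.
by apply: (ideal_avoid hJ hJa hMa) => i hi h; apply: h2; exists i.
Qed.

Lemma ideal_neq_n1 I : I <> A -> ideal A I -> ~ I 1.
Proof. by move=> hne hI h1; apply: hne; exact: ideal_eqT. Qed.

Lemma prime_neq I : prime_ideal A I -> I <> A.
Proof. by move=> [_ h1 _] e; apply: h1; rewrite e; exact: (sring1 hA). Qed.

Lemma limit_center_maximal : maximal_ideal A M.
Proof.
split=> //; first exact: prime_neq.
move=> J hJ hMJ; have [hJ1|hJ1] := pselect (J 1); first by right; exact: ideal_eqT.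
left; apply/seteqP; split=> //.
have [//|[i hi hJi]] := proper_sub_center hJ hJ1.
(* Now [M] is inside [M_ i], so [V i = U] and the two centers coincide. *)
suff e : M_ i = M by rewrite -e.
rewrite /M_ /M (limit_center_sub hi) //; exact: subset_trans hJi.
Qed.

Lemma maximal_cases N : maximal_ideal A N -> N = M \/ exists2 i, (1 <= i)%N & N = M_ i.
Proof.
move=> [hN hne hmax].
have [h|[i hi h]] := proper_sub_center hN (ideal_neq_n1 hne hN).
  by left; have [->//|e] := hmax _ MU_ideal h; case: (prime_neq MU_prime).
by right; exists i => //; have [->//|e] := hmax _ (M_ideal hi) h; case: (prime_neq (M_prime hi)).
Qed.

(** Finitely many generators are nonunits of [V n] simultaneously for all large [n]. Then [M] is
    inside [M_ n], so [V n = U] for all large [n], against [distinctV]. *)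
Lemma limit_center_not_fg : ~ fg_ideal A M.
Proof.
move=> [X /finite_seqP [s ->] eM].
have hs z : z \in s -> M z by move=> hz; rewrite eM; exact: sub_ideal_span.
have [N hN] : exists N, forall z, z \in s -> forall n, (N <= n)%N -> vmax n z.
  elim: s hs {eM} => [|z s IH] hs; first by exists 0%N.
  have [N hN] : exists N, forall z, z \in s -> forall n, (N <= n)%N -> vmax n z.
    by apply: IH => y hy; apply: hs; rewrite inE hy orbT.
  have [N' hN'] : exists N, forall n, (N <= n)%N -> vmax n z.
    have [|_ [->|/limit_ringPn [N' hN']]] := hs z; first by rewrite inE eqxx.
      by exists 0%N => n _; left.
    by exists N' => n hn; right; exact: hN'.
  exists (maxn N N') => y; rewrite inE => /orP[/eqP ->|hy] n; rewrite geq_max => /andP[h1 h2].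
    exact: hN'.
  exact: hN.
have hV' n : (maxn N 1 <= n)%N -> V n = U.
  rewrite geq_max => /andP[hn1 hn2]; apply: limit_center_sub => //.
  rewrite eM; apply: ideal_span_sub; first exact: M_ideal.
  move=> z hz; split; last exact: hN.
  by case: (hs z hz).
apply: (distinctV (n := maxn N 1)); rewrite !hV' //.
Qed.

Lemma center_uniformizer i : (1 <= i)%N ->
  exists p, [/\ M_ i p, p != 0 & forall z, M_ i z -> V i (z / p)].
Proof.
move=> hi; have [p p0 [hp hpz]] := uniformizerV i.
have := vmax_sub (hV i) hp; rewrite -{1}(localization_center hi) => -[a [s [ha hs hsM e]]].
have [s0 hVs'] := center_inv hs hsM.
have ea : a = s * p by rewrite e; field.
exists a; split.
- by split=> //; rewrite ea; apply: (idM (vmaxI i)) => //; exact: hs.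
- by rewrite ea mulf_neq0.
- move=> z [_ hz]; have -> : z / a = s^-1 * (z / p) by rewrite ea; field; rewrite s0 p0.
  by apply: (sringM (hVs i)) => //; exact: hpz.
Qed.

(** Let [q] be a nonzero prime below [M_ i], [z] nonzero in [q] and [w] in [M_ i]. A power of [w] is
    a multiple of [z] in [V i]; clearing a denominator outside [M_ i] puts it into [q], so [q] is
    all of [M_ i]. *)
Lemma center_height1 i : (1 <= i)%N -> height A (M_ i) 1.
Proof.
move=> hi; have [p [hp p0 _]] := center_uniformizer hi.
split.
  exists (fun k => if k is 0%N then [set 0] else M_ i) => //; split.
    case=> [_|k _]; last exact: M_prime.
    split; first exact: zero_ideal hA.
    - by move/eqP; rewrite oner_eq0.
    - by move=> a b _ _ /eqP; rewrite mulf_eq0 => /orP[] /eqP; [left|right].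
  case=> [_|//]; split; first by move=> _ ->; exact: (id0 (M_ideal hi)).
  by move=> h; move: (h _ hp) => /eqP; rewrite (negPf p0).
move=> n q [hq1 hq2] hqn; rewrite leqNgt; apply/negP => hn.
have hlast k : (n = k.+2)%N -> False.
  move=> e; have hk1 : (k.+1 < n)%N by rewrite e.
  have hk0 : (k < n)%N by exact: ltnW.
  have [_ hq0] := hq2 _ hk0; have [hq3 hq4] := hq2 _ hk1.
  rewrite -e hqn in hq3 hq4.
  have [hQ _ hQp] := hq1 _ (ltnW hk1).
  have [hQ0 _ _] := hq1 _ (ltnW hk0).
  have [z hz z0] : exists2 z, q k.+1 z & z != 0.
    apply: contrapT => hno; apply: hq0 => z hz.
    suff -> : z = 0 by exact: (id0 hQ0).
    by apply/eqP; apply: contrapT => h; apply: hno; exists z => //; apply/negP.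
  have [w hw hwq] : exists2 w, M_ i w & ~ q k.+1 w.
    by apply: contrapT => hno; apply: hq4 => w hw; apply: contrapT => h; apply: hno; exists w.
  have hzA := idS hQ hz; have [hwA hwv] := hw.
  have [l hl] := archV hwv (hAV hi hzA) z0.
  rewrite -(localization_center hi) in hl; have [a [s [ha hs hsM es]]] := hl.
  have [s0 _] := center_inv hs hsM.
  have hsw : q k.+1 (s * w ^+ l).
    have -> : s * w ^+ l = a * z.
      by rewrite -[w ^+ l](divfK z0) es; field.
    exact: (idM hQ).
  have hwl j : ~ q k.+1 (w ^+ j).
    elim: j => [|j IH]; first by rewrite expr0; case: (hq1 _ (ltnW hk1)).
    by rewrite exprS => /hQp [] //; exact: (sringX hA).
  have [|h|h] := hQp s (w ^+ l) hs _ hsw; first exact: (sringX hA).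
    by apply: hsM; exact: hq3.
  exact: (hwl l).
by case: n hn hlast {hq1 hq2 hqn} => [|[|n]] // _ /(_ n erefl).
Qed.

(** The generators are chosen so that [I : z], for [z] in [M_ i], escapes every center: [a] escapes
    [M] and all [M_ j] with [j >= N], [b j] escapes the earlier ones different from [M_ i], and the
    uniformizer [p] handles [M_ i] itself. By [proper_sub_center] the colon ideal then contains
    [1]. *)
Lemma center_fg i : (1 <= i)%N -> maximal_ideal A (M_ i) -> M_ i <> M -> fg_ideal A (M_ i).
Proof.
move=> hi [_ hne hmax] hneM.
have hsub J : prime_ideal A J -> M_ i `<=` J -> J = M_ i.
  by move=> hJ h; have [||e] // := hmax J _ h; [case: hJ|case: (prime_neq hJ)].
have [a hia hMa] : exists2 a, M_ i a & ~ M a.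
  apply: contrapT => hno; apply: hneM; apply/esym; apply: hsub => // z hz.
  by apply: contrapT => h; apply: hno; exists z.
have [a0 [N hN]] := center_inv (proj1 hia) hMa.
have [p [hp p0 hpz]] := center_uniformizer hi.
have /choice [b hb] j : exists b, M_ i b /\ (M_ i `<=` M_ j \/ ~ M_ j b).
  have [h|h] := pselect (M_ i `<=` M_ j); first by exists a; split=> //; left.
  apply: contrapT => hno; apply: h => z hz; apply: contrapT => h.
  by apply: hno; exists z; split=> //; right.
pose s := p :: a :: [seq b j | j <- iota 0 N].
have hsM z : z \in s -> M_ i z.
  rewrite !inE => /or3P[/eqP ->|/eqP ->|/mapP [j _ ->]] //.
  by case: (hb j).
have hsA : [set` s] `<=` A by move=> z /hsM [].
exists [set` s]; first exact: finite_seq.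
apply/seteqP; split; last by apply: ideal_span_sub; [exact: M_ideal|exact: hsM].
pose I := ideal_span A [set` s].
have hI : ideal A I by exact: ideal_span_ideal.
have hsI z : z \in s -> I z by move=> hz; exact: sub_ideal_span.
move=> z hz; have hzA : A z by case: hz.
have hsC y : y \in s -> colon A I z y.
  by move=> hy; split; [exact: hsA|apply: (idMr hI) => //; exact: hsI].
have hC : ideal A (colon A I z) by exact: colon_ideal.
apply: contrapT => hIz.
have [|h|[j hj h]] := proper_sub_center hC.
- by case=> _; rewrite mul1r.
- by apply: hMa; apply: h; apply: hsC; rewrite !inE eqxx orbT.
have [hjN|hjN] := ltnP j N; last first.
  have [_ []] : M_ j a by apply: h; apply: hsC; rewrite !inE eqxx orbT.
    by move/eqP; rewrite (negPf a0).
  by apply; exact: hN.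
have [_ [hij|hbj]] := hb j; last first.
  apply: hbj; apply: h; apply: hsC; rewrite !inE map_f ?orbT //.
  by rewrite mem_iota.
have e : M_ j = M_ i by apply: hsub => //; exact: M_prime.
rewrite e in h; have := hpz z hz; rewrite -(localization_center hi).
move=> [al [t [hal ht htM et]]]; have [t0 _] := center_inv ht htM.
apply: htM; apply: h; split=> //.
have -> : t * z = al * p by rewrite -[z](divfK p0) et; field.
by apply: (idM hI) => //; apply: hsI; rewrite !inE eqxx.
Qed.

Lemma limit_boundary : boundary_valuation_ring V
  (exist _ U (mem_set hU) : zar F).
Proof.
set Uz : zar F := exist _ U (mem_set hU).
pose Vz n : zar F := exist _ (V n) (mem_set (hV n)).
have hnb N0 : nbhs Uz N0 -> exists n0, forall n, (n0 <= n)%N -> N0 (Vz n).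
  move/zar_nbhsP => [[X Y] [[/= hX hY] [/= hX1 hY1] hsub]].
  have [n1 hn1] : exists n1, forall n, (n1 <= n)%N -> X `<=` V n.
    move/finite_seqP: hX hX1 => [s ->]; elim: s => [|z s IH] hs; first by exists 0%N.
    have [n1 hn1] : exists n1, forall n, (n1 <= n)%N -> [set` s] `<=` V n.
      by apply: IH => y hy; apply: hs; rewrite /= inE hy orbT.
    have [n2 hn2] : U z by apply: hs; rewrite /= inE eqxx.
    exists (maxn n1 n2) => n; rewrite geq_max => /andP[h1 h2] y /=.
    by rewrite inE => /orP[/eqP ->|hy]; [exact: hn2|exact: hn1 h1 _ hy].
  have [n2 hn2] : exists n1, forall n, (n1 <= n)%N -> Y `<=` ~` V n.
    move/finite_seqP: hY hY1 => [s ->]; elim: s => [|z s IH] hs; first by exists 0%N.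
    have [n2 hn2] : exists n1, forall n, (n1 <= n)%N -> [set` s] `<=` ~` V n.
      by apply: IH => y hy; apply: hs; rewrite /= inE hy orbT.
    have [|n3 hn3] := @limit_ringPn z; first by apply: hs; rewrite /= inE eqxx.
    exists (maxn n2 n3) => n; rewrite geq_max => /andP[h1 h2] y /=.
    by rewrite inE => /orP[/eqP ->|hy]; [exact: hn3|exact: hn2 h1 _ hy].
  exists (maxn n1 n2) => n; rewrite geq_max => /andP[h1 h2]; apply: hsub.
  by split; [exact: hn1|exact: hn2].
apply/seteqP; split=> W.
  move=> hW; apply: contrapT => hne.
  have [N0 [hN0 hN0U hshape]] := zar_sep hne.
  have [n0 hn0] : exists n0, forall n, (n0 <= n)%N -> ~ N0 (Vz n).
    case: hshape hN0U {hN0} => -[t ->] /=.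
      by move/limit_ringPn => [n0 h]; exists n0.
    by move/contrapT => [n0 h]; exists n0 => n /h hV' h'.
  (* The finitely many [V n] with [n < n0] that differ from [W] are separated from it one by one. *)
  have [N1 hN1 hN1V] : exists2 N1, nbhs W N1 &
      forall n, (n < n0)%N -> Vz n <> W -> ~ N1 (Vz n).
    elim: (n0) => [|k [N1 hN1 hk]]; first by exists setT => //; exact: filterT.
    have [e|hneV] := pselect (Vz k = W).
      exists N1 => // n; rewrite ltnS leq_eqVlt => /orP[/eqP ->|]; last exact: hk.
      by move=> h; case: (h e).
    have [|N2 [hN2 hN2V _]] := @zar_sep _ W (Vz k); first by move=> e; exact: hneV.
    exists (N1 `&` N2); first exact: filterI.
    move=> n; rewrite ltnS leq_eqVlt => /orP[/eqP -> _ []//|hn hnV [h1 _]].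
    exact: (hk n).
  have [y [hyW [n _ hn] [hy0 hy1]]] := hW _ (filterI hN0 hN1).
  have ey : y = Vz n by apply: val_inj.
  rewrite ey in hyW hy0 hy1.
  have [hlt|hge] := ltnP n n0; last exact: (hn0 n).
  by apply: (hN1V n) => //; exact/eqP.
move=> -> N0 /hnb [n0 hn0].
(* A limit point needs a member different from [U]; of two consecutive [V n] at least one
   qualifies. *)
have [e|hne] := pselect (V n0 = U).
  exists (Vz n0.+1); split; last exact: hn0.
  - by apply/eqP => /(congr1 val) /= e'; apply: (distinctV (n := n0)); rewrite e' e.
  - by exists n0.+1.
exists (Vz n0); split; last exact: hn0.
- by apply/eqP => /(congr1 val).
- by exists n0.
Qed.

Theorem prufer_boundary :
  prufer_domain A /\
  exists2 W : zar F, boundary_valuation_ring V W &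
    exists M : set F,
      [/\ maximal_ideal A M /\ ~ (fg_ideal A M /\ height A M 1),
          forall N, maximal_ideal A N -> ~ (fg_ideal A N /\ height A N 1) ->
            N = M
        & val W = localization A M].
Proof.
split; first exact: holomorphy_prufer.
exists (exist _ U (mem_set hU) : zar F); first exact: limit_boundary.
exists M; split; last by rewrite localization_limit_center.
- by split; [exact: limit_center_maximal|case=> /limit_center_not_fg].
- move=> N hN hN'; have [//|[i hi e]] := maximal_cases hN.
  apply: contrapT => hne; apply: hN'; rewrite e in hN hne *.
  by split; [exact: center_fg|exact: center_height1].
Qed.

End SequenceOfValuations.

(** * Order valuations along a sequence of transforms *)

Section OrderValuation.
Variables (F : fieldType) (S M V : set F) (x : F).
Hypotheses (hS : subring S) (hM : ideal S M) (hM1 : ~ M 1).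
Local Notation pow := (ideal_pow S M).
Hypothesis frac : forall z, exists a b, [/\ S a, S b, b != 0 & z = a / b].
Hypothesis ordE : forall a, S a -> a != 0 -> exists r, pow r a /\ ~ pow r.+1 a.
Hypothesis ordM : forall r s a b, pow r a -> ~ pow r.+1 a -> pow s b -> ~ pow s.+1 b ->
  ~ pow (r + s).+1 (a * b).
Hypotheses (Mx : M x) (x2 : ~ pow 2 x).
Hypothesis VP : forall z, V z <-> exists r a b, [/\ pow r a, pow r b, ~ pow r.+1 b & z = a / b].

Let hpow r := ideal_pow_ideal hS hM r.

Lemma notin_pow_neq0 r b : ~ pow r b -> b != 0.
Proof. by move=> h; apply/eqP => e; apply: h; rewrite e; exact: (id0 (hpow r)). Qed.

Lemma pow1_n1 : ~ pow 1 1.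
Proof. by rewrite (ideal_pow1E hS hM). Qed.

Lemma expn_notin_pow r b k : pow r b -> ~ pow r.+1 b -> ~ pow (r * k).+1 (b ^+ k).
Proof.
move=> hb hb'; elim: k => [|k IH]; first by rewrite muln0 expr0; exact: pow1_n1.
by rewrite exprS mulnS; apply: ordM => //; exact: (ideal_powX hS hM).
Qed.

Lemma order_quotient r a b : pow r a -> pow r b -> ~ pow r.+1 b -> V (a / b).
Proof. by move=> ha hb hb'; apply/VP; exists r, a, b. Qed.

Lemma order_quotientN r a b : pow r.+1 a -> pow r b -> ~ pow r.+1 b -> a != 0 -> ~ V (b / a).
Proof.
move=> ha hb hb' a0 /VP [s [c [d [hc hd hd' e]]]].
have d0 := notin_pow_neq0 hd'.
apply: (ordM hb hb' hd hd'); rewrite -addSn.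
have -> : b * d = a * c.
  by apply/eqP; rewrite [a * c]mulrC -eqr_div //; apply/eqP.
exact: (ideal_powD hS hM).
Qed.

Lemma order_valuation_ring_valuation : valuation_ring V.
Proof.
split.
  apply/subringP; split.
  - rewrite -(divr1 1); apply: (@order_quotient 0) => //; last exact: pow1_n1.
      exact: (sring1 hS).
    exact: (sring1 hS).
  - move=> _ _ /VP [r [a [b [ha hb hb' ->]]]] /VP [s [c [d [hc hd hd' ->]]]].
    have -> : a / b - c / d = (a * d - b * c) / (b * d).
      by field; rewrite (notin_pow_neq0 hb') (notin_pow_neq0 hd').
    apply: (@order_quotient (r + s)); [|exact: (ideal_powD hS hM)|exact: ordM].
    by apply: (idB hS (hpow _)); exact: (ideal_powD hS hM).
  - move=> _ _ /VP [r [a [b [ha hb hb' ->]]]] /VP [s [c [d [hc hd hd' ->]]]].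
    rewrite mulf_div; apply: (@order_quotient (r + s)); last exact: ordM.
      exact: (ideal_powD hS hM).
    exact: (ideal_powD hS hM).
move=> z z0; have [a [b [ha hb b0 e]]] := frac z.
have a0 : a != 0 by apply/eqP => a0; case/eqP: z0; rewrite e a0 mul0r.
have [r [hr hr']] := ordE ha a0; have [s [hs hs']] := ordE hb b0.
have [hle|hlt] := leqP s r.
  by left; rewrite e; apply: (order_quotient _ hs hs'); exact: (ideal_pow_le hS hM hle).
right; rewrite e invf_div; apply: (order_quotient _ hr hr').
exact: (ideal_pow_le hS hM (ltnW hlt)).
Qed.

Lemma order_vmax z : valuation_max V z -> z != 0 ->
  exists r a b, [/\ pow r.+1 a, pow r b, ~ pow r.+1 b & z = a / b].
Proof.
move=> [->|hz] z0; first by rewrite eqxx in z0.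
have [a [b [ha hb b0 e]]] := frac z.
have a0 : a != 0 by apply/eqP => a0; case/eqP: z0; rewrite e a0 mul0r.
have [r [hr hr']] := ordE ha a0; have [s [hs hs']] := ordE hb b0.
exists s, a, b; split=> //; have [hlt|hle] := ltnP s r.
  exact: (ideal_pow_le hS hM hlt).
case: hz; rewrite e invf_div; apply: (order_quotient _ hr hr').
exact: (ideal_pow_le hS hM hle).
Qed.

Lemma order_arch p q : valuation_max V p -> V q -> q != 0 -> exists k, V (p ^+ k / q).
Proof.
move=> hp /VP [s [c [d [hc hd hd' ->]]]] q0.
have d0 := notin_pow_neq0 hd'.
have c0 : c != 0 by apply/eqP => c0; case/eqP: q0; rewrite c0 mul0r.
have [hVs _] := order_valuation_ring_valuation.
have [->|p0] := eqVneq p 0; first by exists 1%N; rewrite expr1 mul0r; exact: (sring0 hVs).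
have [r [a [b [ha hb hb' ->]]]] := order_vmax hp p0.
have b0 := notin_pow_neq0 hb'.
have [t [ht ht']] := ordE (idS (hpow s) hc) c0.
(* The exponent is the order of the numerator of [q]: [p] has value at least [1] and [q] at most
   [t]. *)
exists t; have -> : (a / b) ^+ t / (c / d) = (a ^+ t * d) / (b ^+ t * c).
  by rewrite expr_div_n; field; rewrite c0 d0 expf_neq0.
apply: (@order_quotient (r * t + t)).
- have := ideal_powX hS hM t ha; rewrite mulSn addnC => h.
  by apply: (idMr (hpow _)) => //; exact: (idS (hpow s)).
- by apply: (ideal_powD hS hM) => //; exact: (ideal_powX hS hM).
- by apply: ordM => //; [exact: (ideal_powX hS hM)|exact: expn_notin_pow].
Qed.

Lemma order_uniformizer : exists2 p, p != 0 &
  valuation_max V p /\ forall z, valuation_max V z -> V (z / p).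
Proof.
have x0 := notin_pow_neq0 x2; have hx1 := ideal_pow1 hS Mx.
have [hVs _] := order_valuation_ring_valuation.
exists x => //; split.
  right; rewrite -div1r; apply: (@order_quotientN 0) => //; last exact: pow1_n1.
  exact: (sring1 hS).
move=> z hz; have [->|z0] := eqVneq z 0; first by rewrite mul0r; exact: (sring0 hVs).
have [r [a [b [ha hb hb' ->]]]] := order_vmax hz z0.
rewrite -mulrA -invfM; apply: (@order_quotient r.+1) => //.
  by rewrite -addn1; exact: (ideal_powD hS hM).
by rewrite -addn1; exact: ordM.
Qed.

End OrderValuation.

(** * Transforms of a fraction along the sequence *)

Section TransformSequence.
Variables (F : fieldType) (R m V : nat -> set F) (x : nat -> F).
Hypotheses (hR : forall n, subring (R n)) (hm : forall n, ideal (R n) (m n)).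
Hypothesis hm1 : forall n, ~ m n 1.
Local Notation pow n := (ideal_pow (R n) (m n)).
Hypothesis frac : forall n z, exists a b, [/\ R n a, R n b, b != 0 & z = a / b].
Hypothesis ordE : forall n a, R n a -> a != 0 -> exists r, pow n r a /\ ~ pow n r.+1 a.
Hypothesis ordM : forall n r s a b, pow n r a -> ~ pow n r.+1 a -> pow n s b -> ~ pow n s.+1 b ->
  ~ pow n (r + s).+1 (a * b).
Hypotheses (mx : forall n, m n (x n)) (x2 : forall n, ~ pow n 2 (x n)).
Hypothesis step_in : forall n r a, pow n r a -> R n.+1 (a / x n ^+ r).
Hypothesis step_order : forall n r a, pow n r a -> ~ pow n r.+1 a ->
  ~ pow n.+1 r.+1 (a / x n ^+ r).
Hypothesis m_mono : forall n, m n `<=` m n.+1.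
Hypothesis VP : forall n z, V n z <->
  exists r a b, [/\ pow n r a, pow n r b, ~ pow n r.+1 b & z = a / b].
(** Such a [y] separates consecutive order valuation rings: its inverse is in [V n], but not in
    [V n.+1], where [y] has positive value. *)
Hypothesis sep : forall n, exists y, [/\ m n.+1 y, y != 0 & V n y^-1].

Let hpow n r := ideal_pow_ideal (hR n) (hm n) r.
Let quot n := order_quotient (VP n).
Let quotN n := order_quotientN (hR n) (hm n) (@ordM n) (VP n).
Let nz n := @notin_pow_neq0 _ _ _ (hR n) (hm n).

Let hV n : valuation_ring (V n).
Proof. exact: (order_valuation_ring_valuation (hR n) (hm n) (@hm1 n) (frac n) (@ordE n) (@ordM n) (VP n)). Qed.

Let x0 n : x n != 0. Proof. exact: nz (@x2 n). Qed.

(* [(a, b)] stands for a transform in [R n], of order at least [e], of the ideal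
   generated by the numerator and the denominator of [t]. *)
Definition fraction_at (t : F) e n a b :=
  [/\ pow n e a, pow n e b, a != 0, b != 0 & t = a / b].

Lemma fraction_step t e n a b : fraction_at t e n a b ->
  R n.+1 (a / x n ^+ e) /\ R n.+1 (b / x n ^+ e) /\ t = (a / x n ^+ e) / (b / x n ^+ e).
Proof.
move=> [h1 h2 h3 h4 h5]; split; first exact: step_in.
split; first exact: step_in.
by rewrite h5; field; rewrite h4 expf_neq0.
Qed.

(* The order of the transforms of an ideal does not increase, so it is eventually
   a constant [e]; from then on an element of order [e] keeps this order. *)
Lemma stable_fractions t : t != 0 -> exists e N (a b : nat -> F),
  [/\ forall i, fraction_at t e (N + i) (a i) (b i),
      forall i, ~ pow (N + i) e.+1 (a i) \/ ~ pow (N + i) e.+1 (b i),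
      forall i, a i.+1 = a i / x (N + i)%N ^+ e
    & forall i, b i.+1 = b i / x (N + i)%N ^+ e].
Proof.
move=> t0.
pose E e := exists n a b, fraction_at t e n a b /\ (~ pow n e.+1 a \/ ~ pow n e.+1 b).
have hE n a b : R n a -> R n b -> a != 0 -> b != 0 -> t = a / b ->
    exists2 e, fraction_at t e n a b & ~ pow n e.+1 a \/ ~ pow n e.+1 b.
  move=> ha hb a0 b0 e.
  have [r [hr hr']] := ordE ha a0; have [s [hs hs']] := ordE hb b0.
  have [hle|hlt] := leqP r s.
    exists r; last by left.
    by split=> //; exact: (ideal_pow_le (hR n) (hm n) hle).
  exists s; last by right.
  by split=> //; exact: (ideal_pow_le (hR n) (hm n) (ltnW hlt)).
have neq0 a b : t = a / b -> b != 0 -> a != 0.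
  by move=> e b0; apply/eqP => a0; case/eqP: t0; rewrite e a0 mul0r.
have [e [[N [a [b [hab hab']]]] hmin]] : exists e, E e /\ forall e', (e' < e)%N -> ~ E e'.
  have [e he] : exists e, E e.
    have [a [b [ha hb b0 e]]] := frac 0 t.
    have [e' h1 h2] := hE 0%N a b ha hb (neq0 _ _ e b0) b0 e.
    by exists e', 0%N, a, b.
  elim/ltn_ind: e he => e IH he.
  have [h|/existsNP [e' /not_implyP [h1 /contrapT h2]]] :=
    pselect (forall e', (e' < e)%N -> ~ E e'); first by exists e.
  exact: IH h1 h2.
pose A := fix A i := if i is k.+1 then A k / x (N + k)%N ^+ e else a.
pose B := fix B i := if i is k.+1 then B k / x (N + k)%N ^+ e else b.
exists e, N, A, B.
suff h i : fraction_at t e (N + i) (A i) (B i) /\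
    (~ pow (N + i) e.+1 (A i) \/ ~ pow (N + i) e.+1 (B i)).
  by split=> // i; case: (h i).
elim: i => [|i [IH1 IH2]]; first by rewrite addn0.
have [h1 [h2 h3]] := fraction_step IH1.
rewrite addnS /=; set A' := A i / _ in h1 h3 *; set B' := B i / _ in h2 h3 *.
have [hA hB hA0 hB0 _] := IH1.
have hA'0 : A' != 0 by rewrite mulf_neq0 // invr_eq0 expf_neq0.
have hB'0 : B' != 0 by rewrite mulf_neq0 // invr_eq0 expf_neq0.
have hor : ~ pow (N + i).+1 e.+1 A' \/ ~ pow (N + i).+1 e.+1 B'.
  by case: IH2 => h; [left|right]; exact: step_order.
have [e' h4 h5] := hE _ _ _ h1 h2 hA'0 hB'0 h3.
have hee' : (e <= e')%N.
  by rewrite leqNgt; apply/negP => hlt; apply: (hmin _ hlt); exists (N + i).+1, A', B'.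
split=> //; have [hA' hB' _ _ _] := h4.
have hle := ideal_pow_le (hR (N + i).+1) (hm (N + i).+1) hee'.
by split=> //; exact: hle.
Qed.

(** If numerator and denominator both have order [e] at some stage, they keep it and [t] is a unit
    from then on. Otherwise the one that starts with order [e] keeps it while the other always has
    larger order, which fixes the sign. In the unit case [N] is quantified before [k], as
    [geom_order_valuation] requires. *)
Lemma eventual_order t : t != 0 -> exists N,
  [\/ forall n, (N <= n)%N -> ~ V n t, forall n, (N <= n)%N -> ~ V n t^-1
    | (forall n, (N <= n)%N -> V n t /\ V n t^-1) /\
      forall k, geom k t != 0 -> V N (geom k t)^-1 ->
        forall n, (N <= n)%N -> V n (geom k t)^-1].
Proof.
move=> t0; have [e [N [a [b [hab hor ha hb]]]]] := stable_fractions t0.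
have [[i0 hia hib]|hno] := pselect (exists2 i, ~ pow (N + i) e.+1 (a i) & ~ pow (N + i) e.+1 (b i)).
  have hboth i : ~ pow (N + (i0 + i)) e.+1 (a (i0 + i)%N) /\ ~ pow (N + (i0 + i)) e.+1 (b (i0 + i)%N).
    elim: i => [|i [IH1 IH2]]; first by rewrite addn0.
    have [h1 h2 _ _ _] := hab (i0 + i)%N.
    by rewrite !addnS ha hb; split; exact: step_order.
  exists (N + i0)%N; apply: Or33.
  have hn n : (N + i0 <= n)%N -> exists i, n = (N + (i0 + i))%N.
    by move=> h; exists (n - (N + i0))%N; rewrite addnA subnKC.
  split=> [n /hn [i ->]|k hk0 hkV n /hn [i ->]].
    have [h1 h2 h3 h4 ->] := hab (i0 + i)%N; have [h5 h6] := hboth i.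
    by split; [exact: quot h1 h2 h6|rewrite invf_div; exact: quot h2 h1 h5].
  (* [geom k t] made homogeneous of degree [k] in numerator and denominator. It is transformed with
     exponent [e k], so once its order is exactly [e k] it stays so. *)
  pose g i := \sum_(0 <= j < k.+1) a i ^+ j * b i ^+ (k - j).
  have hg i' : geom k t = g i' / b i' ^+ k.
    have [_ _ _ b0 e'] := hab i'.
    rewrite /geom /g mulr_suml; apply: eq_big_nat => j /andP[_ hj].
    have -> : b i' ^+ k = b i' ^+ (k - j) * b i' ^+ j by rewrite -exprD subnK.
    by rewrite {1}e' expr_div_n; field; rewrite !expf_neq0.
  have hgS i' : g i'.+1 = g i' / x (N + i')%N ^+ (e * k).
    rewrite /g mulr_suml; apply: eq_big_nat => j /andP[_ hj]; rewrite ha hb.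
    have -> : (e * k = e * j + e * (k - j))%N by rewrite -mulnDr subnKC.
    by rewrite !expr_div_n -!exprM exprD; field; rewrite !expf_neq0.
  have hgp i' : pow (N + i') (e * k) (g i').
    have [h1 h2 _ _ _] := hab i'.
    rewrite /g big_nat; apply: (id_sum (hpow _ _)) => j /andP[_ hj].
    have -> : (e * k = e * j + e * (k - j))%N by rewrite -mulnDr subnKC.
    by apply: (ideal_powD (hR _) (hm _)); exact: (ideal_powX (hR _) (hm _)).
  have hbk i' : ~ pow (N + i') e.+1 (b i') -> ~ pow (N + i') (e * k).+1 (b i' ^+ k).
    have [_ h2 _ _ _] := hab i' => h.
    exact: (expn_notin_pow (hR _) (hm _) (@hm1 _) (@ordM _)).
  have hbk' i' : pow (N + i') (e * k) (b i' ^+ k).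
    by have [_ h2 _ _ _] := hab i'; exact: (ideal_powX (hR _) (hm _)).
  have g0 i' : g i' != 0.
    by apply/eqP => e0; case/eqP: hk0; rewrite (hg i') e0 mul0r.
  have hgn i' : ~ pow (N + (i0 + i')) (e * k).+1 (g (i0 + i')%N).
    elim: i' => [|i' IH]; last by rewrite !addnS hgS; exact: step_order.
    rewrite addn0 => hgk; move: hkV; rewrite (hg i0) invf_div.
    exact: quotN hgk (hbk' i0) (hbk i0 hib) (g0 i0).
  rewrite (hg (i0 + i)%N) invf_div; exact: quot (hbk' _) (hgp _) (hgn i).
have persist_a i : ~ pow N e.+1 (a 0%N) -> ~ pow (N + i) e.+1 (a i).
  move=> h; elim: i => [|i IH]; first by rewrite addn0.
  by have [h1 _ _ _ _] := hab i; rewrite addnS ha; exact: step_order.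
have persist_b i : ~ pow N e.+1 (b 0%N) -> ~ pow (N + i) e.+1 (b i).
  move=> h; elim: i => [|i IH]; first by rewrite addn0.
  by have [_ h1 _ _ _] := hab i; rewrite addnS hb; exact: step_order.
exists N; have := hor 0%N; rewrite addn0 => -[h|h].
  apply: Or31 => n /subnKC <-; set i := (n - N)%N.
  have [h1 h2 h3 h4 ->] := hab i.
  have hbi : pow (N + i) e.+1 (b i).
    by apply: contrapT => h'; apply: hno; exists i => //; exact: persist_a.
  by move=> hVab; exact: (quotN hbi h1 (persist_a i h) h4 hVab).
apply: Or32 => n /subnKC <-; set i := (n - N)%N.
have [h1 h2 h3 h4 ->] := hab i; rewrite invf_div.
have hai : pow (N + i) e.+1 (a i).
  by apply: contrapT => h'; apply: hno; exists i => //; exact: persist_b.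
by move=> hVab; exact: (quotN hai h2 (persist_b i h) h3 hVab).
Qed.

Lemma eventually_order_valuation t : t != 0 -> exists N,
  (forall n, (N <= n)%N -> V n t) \/ (forall n, (N <= n)%N -> ~ V n t).
Proof.
move=> t0; have [N [h|h|[h _]]] := eventual_order t0; exists N; [by right|left|left].
  by move=> n /h h'; have [] := valuation_total (hV n) t.
by move=> n /h [].
Qed.

(** The product of the moduli for [n <= N] satisfies these finitely many conditions; beyond [N] the
    sign of [t] decides, or, for a unit [t], the case [n = N] propagates. *)
Lemma geom_order_valuation t : t != 0 -> exists2 k, (0 < k)%N &
  forall n, geom_good (V n) k t.
Proof.
move=> t0; have [N hN] := eventual_order t0.
have /choice [k0 hk0] n : exists k0, (0 < k0)%N /\ forall k, (k0 %| k)%N -> geom_good (V n) k t.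
  by have [k0 h1 h2] := geom_good_exists (hV n) t; exists k0.
pose k := \prod_(i < N.+1) k0 i.
have hk n : (n <= N)%N -> geom_good (V n) k t.
  move=> hn; apply: (hk0 n).2; rewrite -ltnS in hn.
  by rewrite /k (bigD1 (Ordinal hn)) //= dvdn_mulr.
exists k; first by apply: prodn_gt0 => i; case: (hk0 i).
move=> n; have [hn|hn] := leqP n N; first exact: hk.
have hn' := ltnW hn.
case: hN => [h|h|[h1 h2]].
- by apply: geom_good_notW => //; exact: h.
- have htv : valuation_max (V n) t by right; exact: h.
  apply: (geom_good_unit (hV n)); [exact: (vmax_sub (hV n) htv)|exact: (geom_good_vmax (hV n) htv)].
- have [g1 g2 _] := hk N (leqnn N); have [h3 h4] := h1 n hn'.
  have hVs : subring (V n) by case: (hV n).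
  have h5 := h2 k g1 g2 n hn'.
  by split=> //; apply: (sringM hVs) => //; exact: (sringX hVs).
Qed.

Lemma max_notin_V n y : m n y -> y != 0 -> ~ V n y^-1.
Proof.
move=> hy y0; rewrite -div1r; apply: (quotN (r := 0)) => //.
- exact: (ideal_pow1 (hR n)).
- exact: (sring1 (hR n)).
- exact: (pow1_n1 (hR n) (hm n)).
Qed.

Theorem transform_sequence_prufer : let A := \bigcap_(i >= 1) V i in
  prufer_domain A /\
  exists2 W : zar F, boundary_valuation_ring V W &
    exists M : set F,
      [/\ maximal_ideal A M /\ ~ (fg_ideal A M /\ height A M 1),
          forall N, maximal_ideal A N -> ~ (fg_ideal A N /\ height A N 1) ->
            N = M
        & val W = localization A M].
Proof.
apply: prufer_boundary.
- exact: hV.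
- by move=> n p q; exact: (order_arch (hR n) (hm n) (@hm1 n) (frac n) (@ordE n) (@ordM n) (VP n)).
- by move=> n; exact: (order_uniformizer (hR n) (hm n) (@hm1 n) (frac n) (@ordE n) (@ordM n) (mx n) (@x2 n) (VP n)).
- exact: geom_order_valuation.
- exact: eventually_order_valuation.
- exists (x 0%N) => // n; apply: max_notin_V => //.
  elim: n => [//|n IH]; exact: m_mono.
- move=> n e; have [y [hy y0 hyV]] := sep n.
  by apply: (max_notin_V hy y0); rewrite e.
Qed.

End TransformSequence.

(** * Orders and transforms of a regular local ring *)

Section RegularLocalRing.
Variables (F : fieldType) (S M : set F) (x : F).
Hypotheses (reg : regular_local_ring S M) (Mx : M x) (x2 : ~ ideal_pow S M 2 x).
Local Notation pow := (ideal_pow S M).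

Lemma regular_order_exists a : S a -> a != 0 -> exists r, pow r a /\ ~ pow r.+1 a.
Proof.
have [d [xs [j [_ genM xM _]]]] := regular_parameters reg Mx x2.
case: reg => hS noeth locS _.
exact: (order_exists hS noeth locS genM xM).
Qed.

Lemma regular_mul_notin_pow r s a b : pow r a -> ~ pow r.+1 a -> pow s b -> ~ pow s.+1 b ->
  ~ pow (r + s).+1 (a * b).
Proof.
have [d [xs [j [_ genM xM hl]]]] := regular_parameters reg Mx x2.
case: reg => hS noeth locS _.
exact: (mul_notin_pow hS noeth locS genM xM hl).
Qed.

Lemma regular_param_neq0 : x != 0.
Proof.
case: reg => hS noeth locS _; apply/eqP => e; apply: x2; rewrite e.
exact: (id0 (ideal_pow_ideal hS (local_ideal locS) 2)).
Qed.

Lemma regular_localizationP z :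
  localization (blowup_chart S M x) (ideal_span (blowup_chart S M x) M) z <->
  exists r a b, [/\ pow r a, pow r b, ~ pow r.+1 b & z = a / b].
Proof.
case: (reg) => hS noeth locS _.
exact: (order_localizationP hS (local_ideal locS) Mx regular_param_neq0 regular_mul_notin_pow x2).
Qed.

Variables (P N : set F).
Local Notation B := (blowup_chart S M x).
Local Notation T := (localization B P).
Hypotheses (hP : prime_ideal B P) (hMP : M `<=` P) (regT : regular_local_ring T N).

Lemma transform_in r a : pow r a -> T (a / x ^+ r).
Proof.
case: (reg) => hS noeth locS _ ha; apply: (sub_localization (blowup_chart_subring S M x) hP).
by apply/(blowup_chartP hS (local_ideal locS) Mx regular_param_neq0); exists r, a.
Qed.

Lemma transform_notin_pow r a : pow r a -> ~ pow r.+1 a ->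
  ~ ideal_pow T N r.+1 (a / x ^+ r).
Proof.
have [d [xs [j [ej genM xM hl]]]] := regular_parameters reg Mx x2.
case: (reg) => hS noeth locS _; case: regT => _ _ locT _.
have nx0 : xs j != 0 by rewrite ej; exact: regular_param_neq0.
move: locT hP nx0; rewrite -ej => locT hP' nx0.
exact: (transform_order hS noeth locS genM xM hl nx0 hP' hMP locT).
Qed.

Lemma transform_max_sub : P `<=` N.
Proof.
case: regT => _ noeT locT _.
exact: (sub_local_max (blowup_chart_subring S M x) hP noeT locT).
Qed.

End RegularLocalRing.

(** For primes [p 0 < p 1 < p 2], a power of an element of [p 2] is a multiple of a nonzero element
    of [p 1], so [p 2] would be inside [p 1]. *)
Lemma arch_dim_le1 (F : fieldType) (W : set F) d : valuation_ring W ->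
  (forall p q, valuation_max W p -> W q -> q != 0 -> exists k, W (p ^+ k / q)) ->
  krull_dim W d -> (d < 2)%N.
Proof.
move=> hW harch [[p [hp1 hp2]] _]; rewrite ltnNge; apply/negP => hd.
have [hQ0 _ _] := hp1 0%N (leq0n d).
have [hQ hQ1 hQp] := hp1 1%N (ltnW hd).
have [hQ2 hQ21 _] := hp1 2%N hd.
have [z hz z0] : exists2 z, p 1%N z & z != 0.
  apply: contrapT => hno; have [_] := hp2 0%N (ltnW hd); apply=> z hz.
  suff -> : z = 0 by exact: (id0 hQ0).
  by apply/eqP; apply: contrapT => h; apply: hno; exists z => //; apply/negP.
have [w hw hwp] : exists2 w, p 2%N w & ~ p 1%N w.
  apply: contrapT => hno; have [_] := hp2 1%N hd; apply=> w hw.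
  by apply: contrapT => h; apply: hno; exists w.
have hwv : valuation_max W w.
  apply: contrapT => /(vmaxPn) [w0 hwi]; apply: hQ21.
  by rewrite -(mulVf w0); exact: (idM hQ2).
have [k hk] := harch w z hwv (idS hQ hz) z0.
have hWs : subring W by case: hW.
have : p 1%N (w ^+ k) by rewrite -[w ^+ k](divfK z0); exact: (idM hQ).
elim: k {hk} => [|k IH]; first by rewrite expr0.
by rewrite exprS => /hQp [] //; [exact: (idS hQ2)|apply: (sringX hWs); exact: (idS hQ2)].
Qed.

Unset Implicit Arguments.

Theorem corollary5p5 (F : fieldType) (R : set F) (R_ V : nat -> set F) :
  (exists m, regular_local_ring R m) ->
  krull_dim_ge2 R ->
  quotient_field R = setT ->
  R_ 0%N = R ->
  (forall i, overring R (R_ i)) ->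
  (forall i, local_quadratic_transform (R_ i) (R_ i.+1)) ->
  (forall i, krull_dim_ge2 (R_ i.+1)) ->
  (forall i, order_valuation_ring (R_ i) (V i)) ->
  let A := \bigcap_(i >= 1) V i in
  prufer_domain A /\
  exists2 U : zar F, boundary_valuation_ring V U &
    exists M : set F,
      [/\ maximal_ideal A M /\ ~ (fg_ideal A M /\ height A M 1),
          forall N, maximal_ideal A N -> ~ (fg_ideal A N /\ height A N 1) ->
            N = M
        & val U = localization A M].
Proof.
move=> _ _ hquot _ hover hlqt hdim hord.
have /choice [m /choice [x hmx]] i : exists M x P, [/\ regular_local_ring (R_ i) M,
    M x /\ ~ ideal_pow (R_ i) M 2 x, prime_ideal (blowup_chart (R_ i) M x) P, M `<=` P
    & R_ i.+1 = localization (blowup_chart (R_ i) M x) P] by exact: hlqt.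
have /choice [P hmxP] := hmx.
have reg i : regular_local_ring (R_ i) (m i) by case: (hmxP i).
have mx i : m i (x i) by case: (hmxP i) => _ [].
have x2 i : ~ ideal_pow (R_ i) (m i) 2 (x i) by case: (hmxP i) => _ [].
have hP i : prime_ideal (blowup_chart (R_ i) (m i) (x i)) (P i) by case: (hmxP i).
have hmP i : m i `<=` P i by case: (hmxP i).
have eR i : R_ i.+1 = localization (blowup_chart (R_ i) (m i) (x i)) (P i).
  by case: (hmxP i).
have hR i : subring (R_ i) by case: (reg i).
have hm i : ideal (R_ i) (m i) by case: (reg i) => _ _ /local_ideal.
have hm1 i : ~ m i 1 by case: (reg i) => _ _ /local_n1.
have regT i : regular_local_ring (localization (blowup_chart (R_ i) (m i) (x i)) (P i)) (m i.+1).
  by rewrite -eR.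
have frac i z : exists a b, [/\ R_ i a, R_ i b, b != 0 & z = a / b].
  have : quotient_field R z by rewrite hquot.
  move=> [a [b [ha hb hb0 ->]]]; have [_ hsub] := hover i.
  by exists a, b; split=> //; [exact: hsub|exact: hsub|apply/eqP].
have ordE i := regular_order_exists (reg i) (mx i) (x2 i).
have ordM i := regular_mul_notin_pow (reg i) (mx i) (x2 i).
(* The ideal and parameter that define [V i] need not be those of the transform: the ideals agree
   since [R_ i] is local, and the description by orders does not depend on the parameter. *)
have VP i z : V i z <-> exists r a b, [/\ ideal_pow (R_ i) (m i) r a,
    ideal_pow (R_ i) (m i) r b, ~ ideal_pow (R_ i) (m i) r.+1 b & z = a / b].
  have [M' [x' [reg' [hx1 hx2] ->]]] := hord i.
  have eM : M' = m i.
    by case: (reg i) => _ _ [_ h] _; case: reg' => _ _ [h' _] _; exact: h.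
  by rewrite eM in reg' hx1 hx2 *; exact: regular_localizationP.
have hV i := order_valuation_ring_valuation (hR i) (hm i) (hm1 i) (frac i) (ordE i) (ordM i) (VP i).
apply: (@transform_sequence_prufer F R_ m V x) => //.
- by move=> i r a; rewrite eR; exact: (transform_in (reg i) (mx i) (x2 i) (hP i)).
- by move=> i r a ha ha'; rewrite eR; exact: (transform_notin_pow (reg i) (mx i) (x2 i) (hP i) (hmP i) (regT i)).
- by move=> i z /hmP; exact: (transform_max_sub (hP i) (regT i)).
(* An element [a / x^r] of [P i] outside the extension of [m i] has [a] of exact order [r], so its
   inverse is in [V i] and it would serve as [y]. Without such elements [P i] is the extension of
   [m i] and [R_ i.+1] equals [V i], against its dimension. *)
- move=> i; apply: contrapT => hno.
  have x0 := regular_param_neq0 (reg i) (x2 i).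
  have hPspan : P i = ideal_span (blowup_chart (R_ i) (m i) (x i)) (m i).
    have [hPi _ _] := hP i.
    apply/seteqP; split; last exact: ideal_span_sub.
    move=> y hy; apply/(blowup_chart_spanP (hR i) (hm i) (mx i) x0).
    have /(blowup_chartP (hR i) (hm i) (mx i) x0) [r [a [ha ea]]] := idS hPi hy.
    exists r, a; split=> //; apply: contrapT => ha'; apply: hno.
    have a0 := notin_pow_neq0 (hR i) (hm i) ha'.
    exists y; split.
    - exact: (transform_max_sub (hP i) (regT i)).
    - by rewrite ea mulf_neq0 // invr_eq0 expf_neq0.
    - rewrite ea invf_div; apply: (order_quotient (VP i) _ ha ha').
      by have := ideal_powX (hR i) (hm i) r (ideal_pow1 (hR i) (mx i)); rewrite mul1n.
  have eV : R_ i.+1 = V i.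
    apply/seteqP; split=> z; rewrite eR hPspan.
      by move/(regular_localizationP (reg i) (mx i) (x2 i))/VP.
    by move/VP/(regular_localizationP (reg i) (mx i) (x2 i)).
  have [d hd] := hdim i; rewrite eV in hd; rewrite leqNgt => /negP; apply.
  apply: (arch_dim_le1 (hV i) _ hd) => p q.
  exact: (order_arch (hR i) (hm i) (hm1 i) (frac i) (ordE i) (ordM i) (VP i)).
Qed.
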